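(* The map $$\operatorname{Der}_+^\zeta(\overline{\mathsf A}_\bullet)\longrightarrow D_+^1,\qquad(d_i)_{i\ge0}\longmapsto d_1,$$ is (well-defined and) an isomorphism.
   Context: Setting: $V$ is an oriented handlebody of genus $g\ge1$, $D\subset\partial V$ a closed disk, $\Sigma:=\partial V\setminus\operatorname{int}(D)$, $\star\in\partial\Sigma$, $\pi:=\pi_1(\Sigma,\star)$, $F:=\pi_1(V,\star)$, $\varpi:\pi\to F$ induced by inclusion, $\mathsf A:=\ker\varpi$, $\mathbb A:=\mathsf A/[\mathsf A,\mathsf A]$ (a left $\mathbb Z[F]$-module by conjugation, ${}^{\varpi(x)}[a]=[xax^{-1}]$), $\zeta\in\mathsf A$ the class of $\partial\Sigma$ and $[\zeta]\in\mathbb A$ its class. Let $\overline{\mathsf A}_\bullet$ be the extended graded Lie algebra consisting of the group $\overline{\mathsf A}_0=F$ acting on the graded Lie algebra $\overline{\mathsf A}_+=\bigoplus_{m\ge1}\Gamma_m\mathsf A/\Gamma_{m+1}\mathsf A=\operatorname{Lie}(\mathbb A)$ (free Lie algebra). Derivations: for $m\ge1$, a derivation of degree $m$ of $\overline{\mathsf A}_\bullet$ is a family $(d_i)_{i\ge0}$ of maps $d_i:\overline{\mathsf A}_i\to\overline{\mathsf A}_{m+i}$ such that $(d_i)_{i\ge1}$ is a derivation of the graded Lie algebra $\overline{\mathsf A}_+$, $d_0$ is a 1-cocycle ($d_0(ab)=d_0(a)+{}^ad_0(b)$), and $d_i({}^fb)={}^f(d_i(b))+[d_0(f),{}^fb]$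 for $f\in F$, $b\in\overline{\mathsf A}_i$, $i\ge1$. $\operatorname{Der}_+^\zeta(\overline{\mathsf A}_\bullet)$ is the direct sum over $m\ge1$ of the groups of those derivations of degree $m$ with $d_1([\zeta])=0$. The group $F$ acts on $\operatorname{Hom}(\mathbb A,\overline{\mathsf A}_+)$ by $({}^fd)(a)={}^f(d({}^{f^{-1}}a))$. An element $d\in\operatorname{Hom}(\mathbb A,\overline{\mathsf A}_+)$ is quasi-equivariant if for every $f\in F$ there is $v\in\overline{\mathsf A}_+$ with ${}^fd-d=[v,-]$. Then $$D_+^1:=\{d\in\operatorname{Hom}(\mathbb A,\overline{\mathsf A}_+):d\text{ is quasi-equivariant with values in }\overline{\mathsf A}_{\ge2}\text{ and }d([\zeta])=0\},$$ where $\overline{\mathsf A}_{\ge2}=\bigoplus_{m\ge2}\operatorname{Lie}_m(\mathbb A)$. *)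

(* Defs.v *)
From HB Require Import structures.
From mathcomp Require Import all_boot all_algebra.
From mathcomp Require Import boolp classical_sets functions.

Set Implicit Arguments.
Unset Strict Implicit.
Unset Printing Implicit Defensive.

Import GRing.Theory.
Local Open Scope quotient_scope.
Local Open Scope classical_set_scope.
Local Open Scope ring_scope.

(** Groups are [groupType]s (possibly infinite, written multiplicatively), in
    which [x ^ y] is [y^-1 * x * y], so that x a x^-1 is [a ^ x^-1], and
    [[~ x, y]] is [x^-1 * y^-1 * x * y]. *)

Notation "{ 'ghom' G -> H }" := (UMagmaMorphism.type G H)
  (at level 0, G at level 98, H at level 99,
   format "{ 'ghom'  G  ->  H }") : type_scope.

Definition free_basis (I : Type) (G : groupType) (b : I -> G) : Prop :=
  forall (H : groupType) (f : I -> H),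
    (exists h : {ghom G -> H}, forall i, h (b i) = f i) /\
    (forall h h' : {ghom G -> H},
       (forall i, h (b i) = h' (b i)) -> h =1 h').

(** The fundamental groups of a handlebody V of genus [g] and of its boundary
    minus a disk, Sigma: [G] = pi_1(Sigma), [F] = pi_1(V), [w] is induced by the
    inclusion and [zeta] is the class of the boundary of Sigma.  A system of
    meridians [alpha] (bounding disks in V) and parallels [beta] is a basis of
    the free group [G], the images of the parallels form a basis of the free
    group [F], and [zeta] is a product of commutators.  The various conventions
    for that product (orientation of the boundary, ordering, commutator
    brackets) all define the same class of triples: they are exchanged by
    reindexing and by changes of [alpha] and [beta] such as inverting them or
    (alpha, beta) |-> (alpha^-1, alpha beta alpha^-1). *)
Definition handlebody_groups (g : nat) (G F : groupType)
    (w : {ghom G -> F}) (zeta : G) : Prop :=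
  exists alpha beta : 'I_g -> G,
    [/\ free_basis (fun s : 'I_g + 'I_g =>
          match s with inl i => alpha i | inr i => beta i end),
        free_basis (fun i => w (beta i)),
        forall i, w (alpha i) = 1%g
      & zeta = (\prod_(i < g) [~ alpha i, beta i])%g].

Local Ltac gsimp :=
  rewrite ?(commgEl, conjgE) ?(invgM, invgK, invg1) -?mulgA;
  rewrite ?(mulKg, mulVKg, mulgV, mulVg, mulg1, mul1g).

Section LowerCentralSeries.
Local Open Scope group_scope.

Variable G : groupType.
Implicit Types (A H S : set G) (x y z : G).

Definition subgroup H : Prop :=
  H 1 /\ forall x y, H x -> H y -> H (x * y^-1).

Definition gen S : set G := smallest subgroup S.

(** [lcs A n] is Gamma_n A for [n >= 1]; the value [lcs A 0 = A] is a
    convention making the quotient of index [0] below trivial. *)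
Fixpoint lcs A (n : nat) : set G :=
  match n with
  | 0 | 1 => A
  | n'.+1 => gen [set z | exists x y, [/\ lcs A n' x, A y & z = [~ x, y]]]
  end.

Lemma lcsSS A n :
  lcs A n.+2 = gen [set z | exists x y, [/\ lcs A n.+1 x, A y & z = [~ x, y]]].
Proof. by []. Qed.

Lemma subgroupV H x : subgroup H -> H x -> H x^-1.
Proof. by move=> [H1 HF] Hx; have := HF _ _ H1 Hx; rewrite mul1g. Qed.

Lemma subgroupM H x y : subgroup H -> H x -> H y -> H (x * y).
Proof.
move=> sH Hx Hy; rewrite -[y]invgK; apply: (sH.2) => //; exact: subgroupV.
Qed.

Lemma gen_subgroup S : subgroup (gen S).
Proof.
split=> [H [[H1 _] _] //|x y Sx Sy H HS]; apply: (HS.1.2); [exact: Sx|exact: Sy].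
Qed.

Lemma gen_sub S H : subgroup H -> S `<=` H -> gen S `<=` H.
Proof. by move=> sH SH; apply: smallest_sub. Qed.

Lemma sub_gen S : S `<=` gen S.
Proof. exact: sub_gen_smallest. Qed.

Definition normal H : Prop := forall x y, H x -> H (x ^ y).

Lemma subgroup_conj H y : subgroup H -> subgroup [set x | H (x ^ y)].
Proof.
move=> sH; split=> [|a b /= Ha Hb]; first by rewrite /= conj1g; exact: sH.1.
by rewrite conjMg conjVg; apply: sH.2.
Qed.

Lemma lcs_subgroup A n : subgroup A -> subgroup (lcs A n).
Proof. by move=> sA; case: n => [//|[//|n]]; exact: gen_subgroup. Qed.

Lemma lcs_normal A n : subgroup A -> normal A -> normal (lcs A n).
Proof.
move=> sA nA; elim: n => [//|[//|n] IH] x y; rewrite lcsSS.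
move: x; apply: gen_sub; first by apply: subgroup_conj; exact: gen_subgroup.
move=> _ /= [a [b [Aa Ab ->]]]; apply: sub_gen => /=.
by exists (a ^ y), (b ^ y); split; [exact: IH|exact: nA|rewrite conjRg].
Qed.

Lemma lcs_decr A n : subgroup A -> normal A -> lcs A n.+1 `<=` lcs A n.
Proof.
move=> sA nA; case: n => [//|n]; rewrite lcsSS.
have sn := lcs_subgroup n.+1 sA.
apply: gen_sub => // _ [x [y [nx Ay ->]]].
rewrite commgEl; apply: subgroupM => //; first exact: subgroupV.
exact: lcs_normal.
Qed.

Lemma lcs_subA A n : subgroup A -> normal A -> lcs A n `<=` A.
Proof.
move=> sA nA; elim: n => [//|n IH]; apply: (subset_trans _ IH).
exact: lcs_decr.
Qed.

Lemma Hall_Witt x y z :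
  [~ x, y^-1, z] ^ y * [~ y, z^-1, x] ^ z * [~ z, x^-1, y] ^ x = 1.
Proof. by gsimp. Qed.

Lemma commgMr x y z : [~ x, y * z] = [~ x, z] * [~ x, y] ^ z.
Proof. by gsimp. Qed.

Lemma commgMl x y z : [~ x * y, z] = [~ x, z] ^ y * [~ y, z].
Proof. by gsimp. Qed.

Lemma commgV2 x y : [~ x, y^-1] = ([~ x, y]^-1) ^ y^-1.
Proof. by gsimp. Qed.

Lemma lcs_comm_pos A i j x y : subgroup A -> normal A ->
  lcs A i.+1 x -> lcs A j.+1 y -> lcs A (i.+1 + j.+1) [~ x, y].
Proof.
move=> sA nA; elim: j i x y => [|j IH] i x y.
  by rewrite addn1 => ix Ay; apply: sub_gen; exists x, y.
move=> ix; move: y; rewrite lcsSS.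
pose N := lcs A (i.+1 + j.+2).
have sN : subgroup N by exact: lcs_subgroup.
have nN : normal N by exact: lcs_normal.
apply: (@gen_sub _ [set y | N [~ x, y]]).
  split=> [|a b /= Na Nb]; first by rewrite /= commg1; exact: sN.1.
  rewrite commgMr; apply: subgroupM => //; last exact: nN.
  by rewrite commgV2; apply: nN; exact: subgroupV.
move=> _ /= [y [a [jy Aa ->]]].
rewrite -invgR; apply: subgroupV => //.
have := Hall_Witt x y a^-1; rewrite invgK => HW.
have N1 : N ([~ x, y^-1, a^-1] ^ y).
  apply: nN; rewrite /N addnS; apply: sub_gen.
  exists [~ x, y^-1], a^-1; split=> //; last exact: subgroupV.
  by apply: IH => //; apply: subgroupV => //; exact: lcs_subgroup.
have N3 : N ([~ a^-1, x^-1, y] ^ x).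
  apply: nN; rewrite /N -addSnnS; apply: IH => //.
  rewrite -invgR; apply: (subgroupV (lcs_subgroup i.+2 sA)).
  apply: sub_gen; exists x^-1, a^-1; split=> //; last exact: subgroupV.
  exact: (subgroupV (lcs_subgroup i.+1 sA)). 
suff N2 : N ([~ y, a, x] ^ a^-1) by have := nN _ a N2; rewrite -conjgM mulVg conjg1.
have -> : [~ y, a, x] ^ a^-1 =
    ([~ x, y^-1, a^-1] ^ y)^-1 * ([~ a^-1, x^-1, y] ^ x)^-1.
  by apply: (mulgI ([~ x, y^-1, a^-1] ^ y)); rewrite mulVKg;
     apply: (mulIg ([~ a^-1, x^-1, y] ^ x)); rewrite HW mulVg.
by apply: subgroupM => //; exact: subgroupV.
Qed.

Lemma lcs_comm A i j x y : subgroup A -> normal A ->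
  lcs A i x -> lcs A j y -> lcs A (i + j) [~ x, y].
Proof.
move=> sA nA.
have d := @lcs_decr A; have p := @lcs_comm_pos A.
case: i j => [|i] [|j] ix jy; last exact: p.
- exact: (d 1%N sA nA _ (p 0%N 0%N _ _ sA nA ix jy)).
- exact: (d j.+1 sA nA _ (p 0%N j _ _ sA nA ix jy)).
- rewrite addn0; apply: (d i.+1 sA nA); rewrite -addn1.
  exact: (p i 0%N _ _ sA nA ix jy).
Qed.

End LowerCentralSeries.

Definition dprod (I : Type) (T : I -> zmodType) : Type := forall i, T i.

Section DProd.
Variables (I : Type) (T : I -> zmodType).
HB.instance Definition _ := gen_eqMixin (dprod T).
HB.instance Definition _ := gen_choiceMixin (dprod T).
Let zero : dprod T := fun i => 0.
Let opp (x : dprod T) : dprod T := fun i => - x i.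
Let add (x y : dprod T) : dprod T := fun i => x i + y i.
Let addA : associative add.
Proof. by move=> x y z; apply: functional_extensionality_dep => i; exact: addrA. Qed.
Let addC : commutative add.
Proof. by move=> x y; apply: functional_extensionality_dep => i; exact: addrC. Qed.
Let add0 : left_id zero add.
Proof. by move=> x; apply: functional_extensionality_dep => i; exact: add0r. Qed.
Let addN : left_inverse zero opp add.
Proof. by move=> x; apply: functional_extensionality_dep => i; exact: addNr. Qed.
HB.instance Definition _ := GRing.isZmodule.Build (dprod T) addA addC add0 addN.

Lemma dprodB (x y : dprod T) i : (x - y) i = x i - y i. Proof. by []. Qed.
Lemma dprod0 i : (0 : dprod T) i = 0. Proof. by []. Qed.
End DProd.

Section DSum.
Variable T : nat -> zmodType.

Definition finite_support : {pred dprod T} :=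
  fun x => `[< exists N, forall n, (N <= n)%N -> x n = 0 >].

Let finite_support_closed : zmod_closed finite_support.
Proof.
split; first by apply/asboolP; exists 0%N.
move=> x y /asboolP[M xM] /asboolP[N yN]; apply/asboolP; exists (maxn M N) => n.
by rewrite geq_max => /andP[Mn Nn]; rewrite dprodB xM // yN // subr0.
Qed.
HB.instance Definition _ :=
  GRing.isZmodClosed.Build (dprod T) finite_support finite_support_closed.

Record dsum := DSum {
  dsum_val : dprod T;
  dsum_valP : dsum_val \in finite_support }.
HB.instance Definition _ := [isSub for dsum_val].
HB.instance Definition _ := [Choice of dsum by <:].
HB.instance Definition _ := [SubChoice_isSubZmodule of dsum by <:].

Definition component (x : dsum) : forall n, T n := dsum_val x.
Coercion component : dsum >-> Funclass.

Lemma dsum_finite (x : dsum) : exists N, forall n, (N <= n)%N -> x n = 0.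
Proof. exact/asboolP/(dsum_valP x). Qed.

Definition mk_dsum (x : dprod T) (h : exists N, forall n, (N <= n)%N -> x n = 0) :
  dsum := DSum (asboolT h).

Lemma dsumP (x y : dsum) : (forall n, x n = y n) -> x = y.
Proof.
by move=> xy; apply: val_inj; apply: functional_extensionality_dep.
Qed.

Lemma dsumB (x y : dsum) n : (x - y) n = x n - y n.
Proof. exact: (congr1 (fun h : dprod T => h n) (raddfB (val : dsum -> _) x y)). Qed.

Lemma dsum0 n : (0 : dsum) n = 0.
Proof. exact: (congr1 (fun h : dprod T => h n) (raddf0 (val : dsum -> _))). Qed.
End DSum.

Section ExtendedGradedLieAlgebra.
Variables (G F : groupType) (w : {ghom G -> F}).
Implicit Types (n m i j : nat).

Definition kernel : set G := [set x | w x = 1%g].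

Lemma kernel_subgroup : subgroup kernel.
Proof.
split=> [|x y]; rewrite /kernel /=; first exact: gmulf1.
by move=> wx wy; rewrite gmulfF wx wy mulgV.
Qed.

Lemma kernel_normal : normal kernel.
Proof. by move=> x y; rewrite /kernel /= => wx; rewrite gmulfJ wx conj1g. Qed.

Local Notation Gam := (lcs kernel).

Let sG n : subgroup (Gam n) := lcs_subgroup n kernel_subgroup.
Let nG n : normal (Gam n) := lcs_normal (n:=n) kernel_subgroup kernel_normal.

Definition Gam_sub n : Type := {x : G | `[< Gam n x >]}.
HB.instance Definition _ n := Choice.on (Gam_sub n).

Definition Gam_rel n (x y : Gam_sub n) : bool :=
  `[< Gam n.+1 (val x * (val y)^-1)%g >].

Let Gam_rel_equiv n : equiv_class_of (@Gam_rel n).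
Proof.
split=> [x|x y|y x z].
- by apply/asboolP; rewrite mulgV; exact: (sG _).1.
- by apply/idP/idP => /asboolP/(subgroupV (sG _)); rewrite invgF => h;
     apply/asboolP.
- move=> /asboolP xy /asboolP yz; apply/asboolP.
  by have := subgroupM (sG _) xy yz; rewrite divgKA.
Qed.
Canonical Gam_equiv n := EquivRelPack (@Gam_rel_equiv n).

(** Gamma_n / Gamma_(n+1), in degree [n >= 1]; [gr 0] is the zero group. *)
Definition gr n : Type := {eq_quot (Gam_equiv n)}.
HB.instance Definition _ n := Choice.on (gr n).
HB.instance Definition _ n := EqQuotient.on (gr n).

Definition Gam_one n : Gam_sub n := Sub 1%g (asboolT (sG n).1).

(** The class of [x] in [gr n] (and [0] when [x] is not in Gamma_n). *)
Definition cl n (x : G) : gr n := \pi_(gr n) (insubd (Gam_one n) x).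

Definition rep n (u : gr n) : G := val (repr u).

Lemma repP n (u : gr n) : Gam n (rep u).
Proof. by apply/asboolP; exact: (valP (repr u)). Qed.

Lemma repK n (u : gr n) : cl n (rep u) = u.
Proof. by rewrite /cl /rep valKd reprK. Qed.

Lemma cl_eq n x y : Gam n x -> Gam n y ->
  cl n x = cl n y <-> Gam n.+1 (x * y^-1)%g.
Proof.
move=> nx ny; rewrite /cl; split.
  move/eqmodP => /= /asboolP; rewrite !val_insubd.
  by move: nx ny => /asboolP -> /asboolP ->.
move=> h; apply/eqmodP => /=; apply/asboolP; rewrite !val_insubd.
by move: nx ny => /asboolP -> /asboolP ->.
Qed.

Lemma rep_cl n x : Gam n x -> Gam n.+1 (rep (cl n x) * x^-1)%g.
Proof. by move=> nx; apply/(cl_eq (repP _) nx); rewrite repK. Qed.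

Let gr_zero n : gr n := cl n 1%g.
Let gr_opp n (u : gr n) : gr n := cl n (rep u)^-1%g.
Let gr_add n (u v : gr n) : gr n := cl n (rep u * rep v)%g.

Let gr_add_cl n x y : Gam n x -> Gam n y -> gr_add (cl n x) (cl n y) = cl n (x * y)%g.
Proof.
move=> nx ny; apply/cl_eq; try by apply: subgroupM => //; exact: repP.
set x' := rep _; set y' := rep _.
have -> : (x' * y' * (x * y)^-1 = x' * x^-1 * (y' * y^-1) ^ x^-1)%g.
  by gsimp.
by apply: subgroupM => //; [exact: rep_cl|apply: nG; exact: rep_cl].
Qed.

Let gr_ind n (Q : gr n -> Prop) : (forall x, Gam n x -> Q (cl n x)) -> forall u, Q u.
Proof. by move=> h u; rewrite -[u]repK; apply: h; exact: repP. Qed.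

Let gr_addA n : associative (@gr_add n).
Proof.
elim/gr_ind => x nx; elim/gr_ind => y ny; elim/gr_ind => z nz.
by rewrite !gr_add_cl ?mulgA //; apply: subgroupM.
Qed.

Let gr_addC n : commutative (@gr_add n).
Proof.
elim/gr_ind => x nx; elim/gr_ind => y ny; rewrite !gr_add_cl //.
apply/cl_eq; try exact: subgroupM.
have -> : (x * y * (y * x)^-1 = [~ x^-1, y^-1])%g.
  by gsimp.
case: n nx ny => [|n] nx ny.
  exact: (lcs_comm (i := 0) (j := 1) kernel_subgroup kernel_normal
            (subgroupV (sG 0) nx) (subgroupV (sG 1) ny)).
apply: sub_gen; exists x^-1%g, y^-1%g; split=> //.
  exact: (subgroupV (sG n.+1)).
apply: (lcs_subA (n := n.+1) kernel_subgroup kernel_normal).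
exact: (subgroupV (sG n.+1)).
Qed.

Let gr_add0 n : left_id (gr_zero n) (@gr_add n).
Proof. by elim/gr_ind => x nx; rewrite gr_add_cl ?mul1g //; exact: (sG _).1. Qed.

Let gr_addN n : left_inverse (gr_zero n) (@gr_opp n) (@gr_add n).
Proof.
move=> u; rewrite -{2}[u]repK gr_add_cl ?mulVg //; last exact: repP.
by apply: subgroupV => //; exact: repP.
Qed.

HB.instance Definition _ n :=
  GRing.isZmodule.Build (gr n) (@gr_addA n) (@gr_addC n) (@gr_add0 n) (@gr_addN n).

Lemma clM n x y : Gam n x -> Gam n y -> cl n (x * y)%g = cl n x + cl n y.
Proof. by move=> nx ny; rewrite -gr_add_cl. Qed.

Lemma cl1 n : cl n 1%g = 0. Proof. by []. Qed.

Lemma clS n x : Gam n.+1 x -> cl n x = 0.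
Proof.
move=> nx; rewrite -cl1; apply/cl_eq; last by rewrite invg1 mulg1.
  exact: (lcs_decr kernel_subgroup kernel_normal).
exact: (sG _).1.
Qed.

Lemma gr0_eq0 (u : gr 0) : u = 0.
Proof. by elim/gr_ind: u => x nx; rewrite clS. Qed.

Let clJ n x k : Gam n x -> kernel k -> cl n (x ^ k)%g = cl n x.
Proof.
move=> nx kk; apply/cl_eq => //; first exact: nG.
have -> : (x ^ k * x^-1 = [~ x, k] ^ x^-1)%g by gsimp.
apply: (nG (n := n.+1)); case: n nx => [|n] nx; last by apply: sub_gen; exists x, k.
exact: (lcs_comm (i := 0) (j := 1) kernel_subgroup kernel_normal nx kk).
Qed.

Lemma rep_cl_ex n x : Gam n x ->
  exists2 c, Gam n.+1 c & rep (cl n x) = (c * x)%g.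
Proof.
by move=> nx; exists (rep (cl n x) * x^-1)%g; [exact: rep_cl|rewrite mulgVK].
Qed.

(** The action of [F]: [f] acts on classes as conjugation by any preimage of
    [f] under [w] (see [act_cl] below). *)
Definition lift (f : F) : G := xget 1%g [set x | w x = f].

Definition act n (f : F) (u : gr n) : gr n := cl n (rep u ^ (lift f)^-1)%g.

(** The bracket [gr i * gr j -> gr n], to be used for [n = i + j] only.  Leaving
    the target degree free avoids transports along equalities of degrees.
    Replacing [x^-1 y^-1 x y] by [x y x^-1 y^-1] would give the same class. *)
Definition br i j n (u : gr i) (v : gr j) : gr n := cl n [~ rep u, rep v]%g.
Arguments br {i j} n u v.

Let act_conj n f x : Gam n x -> act f (cl n x) = cl n (x ^ (lift f)^-1)%g.
Proof.
move=> nx; apply/(cl_eq (nG _ (repP _)) (nG _ nx)).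
by rewrite -conjVg -conjMg; apply: nG; exact: rep_cl.
Qed.

Lemma actD n f (u v : gr n) : act f (u + v) = act f u + act f v.
Proof.
elim/gr_ind: u => x nx; elim/gr_ind: v => y ny.
rewrite -clM // !act_conj //; last exact: (subgroupM (sG n)).
by rewrite conjMg clM //; exact: nG.
Qed.

Lemma act0 n f : act f (0 : gr n) = 0.
Proof. by apply: (addrI (act f 0)); rewrite -actD !addr0. Qed.

Lemma actB n f (u v : gr n) : act f (u - v) = act f u - act f v.
Proof. by apply/eqP; rewrite eq_sym subr_eq -actD subrK. Qed.

Lemma act_cl n x y : Gam n y -> act (w x) (cl n y) = cl n (y ^ x^-1)%g.
Proof.
move=> ny; rewrite act_conj //; set z := lift (w x).
have wz : w z = w x.
  by apply: (@xgetPex _ 1%g [set y | w y = w x]); exists x.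
have k : kernel (x * z^-1)%g by rewrite /kernel /= gmulfF wz mulgV.
by rewrite -(clJ (nG x^-1%g ny) k) -conjgM mulKg.
Qed.

Lemma br_cl i j x y : Gam i x -> Gam j y ->
  br (i + j) (cl i x) (cl j y) = cl (i + j) [~ x, y]%g.
Proof.
move=> ix jy; rewrite /br.
have [c ic ->] := rep_cl_ex ix; have [d jd ->] := rep_cl_ex jy.
have K a b p q := @lcs_comm _ kernel a b p q kernel_subgroup kernel_normal.
have jdy : Gam j (d * y)%g.
  apply: (subgroupM (sG j)) => //.
  exact: (lcs_decr kernel_subgroup kernel_normal).
have cdy := nG x (K _ _ _ _ ic jdy).
have xd := nG y (K _ _ _ _ ix jd).
rewrite addnS in xd; rewrite addSn in cdy.
have xd' := lcs_decr kernel_subgroup kernel_normal xd.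
have cdy' := lcs_decr kernel_subgroup kernel_normal cdy.
have xy := K _ _ _ _ ix jy.
rewrite commgMl [[~ x, _]%g]commgMr.
rewrite (clM cdy' (subgroupM (sG _) xy xd')) (clM xy xd').
by rewrite (clS cdy) (clS xd) add0r addr0.
Qed.

Lemma brDl i j n (u u' : gr i) (v : gr j) : n = (i + j)%N ->
  br n (u + u') v = br n u v + br n u' v.
Proof.
move=> ->; elim/gr_ind: u => x ix; elim/gr_ind: u' => x' ix'.
elim/gr_ind: v => y jy.
have K p q := @lcs_comm _ kernel i j p q kernel_subgroup kernel_normal.
rewrite -clM // !br_cl //; last exact: (subgroupM (sG _)).
rewrite commgMl clM; [|by apply: nG; exact: K|exact: K].
congr (_ + _).
apply: clJ; first exact: K.
exact: (lcs_subA kernel_subgroup kernel_normal ix').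
Qed.

Lemma brC i j n (u : gr i) (v : gr j) : n = (i + j)%N ->
  br n u v = - br n v u.
Proof.
move=> ->; elim/gr_ind: u => x ix; elim/gr_ind: v => y jy.
rewrite br_cl // addnC br_cl //; apply/eqP; rewrite -addr_eq0 -clM.
- by rewrite -invgR mulVg.
- by rewrite addnC; exact: (lcs_comm kernel_subgroup kernel_normal).
- exact: (lcs_comm kernel_subgroup kernel_normal).
Qed.

Lemma brDr i j n (u : gr i) (v v' : gr j) : n = (i + j)%N ->
  br n u (v + v') = br n u v + br n u v'.
Proof.
move=> nE; rewrite brC // brDl; last by rewrite addnC.
by rewrite opprD -!brC.
Qed.

Lemma br0l i j n (v : gr j) : n = (i + j)%N -> br n (0 : gr i) v = 0.
Proof. by move=> nE; apply: (addrI (br n (0 : gr i) v)); rewrite -(brDl 0 0 v nE) !addr0. Qed.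

Lemma br0r i j n (u : gr i) : n = (i + j)%N -> br n u (0 : gr j) = 0.
Proof. by move=> nE; apply: (addrI (br n u (0 : gr j))); rewrite -(brDr u 0 0 nE) !addr0. Qed.

Lemma brBl i j n (u u' : gr i) (v : gr j) : n = (i + j)%N ->
  br n (u - u') v = br n u v - br n u' v.
Proof. by move=> nE; apply/eqP; rewrite eq_sym subr_eq -(brDl _ _ _ nE) subrK. Qed.

Lemma brBr i j n (u : gr i) (v v' : gr j) : n = (i + j)%N ->
  br n u (v - v') = br n u v - br n u v'.
Proof. by move=> nE; apply/eqP; rewrite eq_sym subr_eq -(brDr _ _ _ nE) subrK. Qed.

(** The positive part, the direct sum of the [gr n] for [n >= 1] (the summand of
    index [0] is zero by [gr0_eq0]). *)
Definition gr_family : nat -> zmodType := fun n => gr n.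
Local Notation Aplus := (dsum gr_family).

Let actp_subproof f (x : Aplus) :
  exists N, forall n, (N <= n)%N -> act f (x n : gr n) = 0.
Proof.
by have [N xN] := dsum_finite x; exists N => n Nn; rewrite xN ?act0.
Qed.
Definition actp f (x : Aplus) : Aplus :=
  @mk_dsum gr_family (fun n => act f (x n : gr n)) (actp_subproof f x).

Let brp_subproof (x y : Aplus) :
  exists N, forall n, (N <= n)%N ->
    \sum_(i < n.+1) br n (x i : gr i) (y (n - i)%N : gr (n - i)) = 0.
Proof.
have [M xM] := dsum_finite x; have [N yN] := dsum_finite y.
exists (M + N)%N => n MNn; apply: big1 => i _.
have nE : n = (i + (n - i))%N by rewrite subnKC // -ltnS.
have [Mi|iM] := leqP M i.
  by rewrite xM // br0l.
rewrite yN ?br0r // -(leq_add2l i) -nE; apply: leq_trans MNn.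
by rewrite leq_add2r ltnW.
Qed.
Definition brp (x y : Aplus) : Aplus :=
  @mk_dsum gr_family
    (fun n => \sum_(i < n.+1) br n (x i : gr i) (y (n - i)%N : gr (n - i)))
    (brp_subproof x y).

Let of_deg1_subproof (a : gr 1) :
  exists N, forall n, (N <= n)%N -> match n return gr n with 1 => a | _ => 0 end = 0.
Proof. by exists 2%N; case=> [|[|n]]. Qed.
Definition of_deg1 (a : gr 1) : Aplus :=
  @mk_dsum gr_family (fun n => match n return gr n with 1 => a | _ => 0 end)
    (of_deg1_subproof a).

(** Derivations of degree [m]: pairs of [d_0] and of the family of the [d_i].
    The conditions on [d_i] are void for [i = 0], since [gr 0] is zero.  The
    target degree is written [i + m] rather than [m + i] so that degree [1 + m]
    is convertible to [m.+1]. *)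
Definition prederivation m : Type :=
  ((F -> gr m) * dprod (fun i => (gr i -> gr (i + m)%N) : zmodType))%type.
HB.instance Definition _ m := GRing.Zmodule.on (prederivation m).

Definition is_derivation m (d : prederivation m) : Prop :=
  let d0 := d.1 in let d_ := d.2 in
  [/\ forall a b : F, d0 (a * b)%g = d0 a + act a (d0 b),
      forall i (u v : gr i), d_ i (u + v) = d_ i u + d_ i v,
      forall i j (u : gr i) (v : gr j),
        d_ (i + j)%N (br (i + j) u v) =
          br (i + j + m) (d_ i u) v + br (i + j + m) u (d_ j v)
    & forall i (f : F) (u : gr i),
        d_ i (act f u) = act f (d_ i u) + br (i + m) (d0 f) (act f u)].

Section Zeta.
Variable z : gr 1.

Definition der_zeta_pred m : {pred prederivation m} :=
  fun d => `[< is_derivation d /\ d.2 1%N z = 0 >].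

Let der_zeta_closed m : zmod_closed (@der_zeta_pred m).
Proof.
have EB (d e : prederivation m) i u : (d - e).2 i u = d.2 i u - e.2 i u by [].
have EB0 (d e : prederivation m) f : (d - e).1 f = d.1 f - e.1 f by [].
split.
  apply/asboolP; split=> //; split=> /=.
  - by move=> a b; rewrite act0 addr0.
  - by move=> i u v; rewrite addr0.
  - by move=> i j u v; rewrite br0l ?br0r ?addr0 // ?addnA // addnAC.
  - by move=> i f u; rewrite act0 br0l ?addr0 // addnC.
move=> d e /asboolP[[d1 d2 d3 d4] dz] /asboolP[[e1 e2 e3 e4] ez].
apply/asboolP; split; last by rewrite EB dz ez subrr.
split.
- by move=> a b; rewrite !EB0 d1 e1 actB opprD addrACA.
- by move=> i u v; rewrite !EB d2 e2 opprD addrACA.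
- move=> i j u v; rewrite !EB d3 e3.
  rewrite (brBl _ _ _ (addnAC i j m)) (brBr _ _ _ (esym (addnA i j m))).
  by rewrite opprD addrACA.
- move=> i f u; rewrite !EB EB0 d4 e4 actB.
  rewrite (brBl _ _ _ (addnC i m)).
  by rewrite opprD addrACA.
Qed.
HB.instance Definition _ m :=
  GRing.isZmodClosed.Build (prederivation m) (@der_zeta_pred m) (@der_zeta_closed m).

(** The group of derivations of degree [m] vanishing on [z]. *)
Record der_zeta m := DerZeta {
  der_val : prederivation m;
  der_valP : der_val \in @der_zeta_pred m }.
HB.instance Definition _ m := [isSub for @der_val m].
HB.instance Definition _ m := [Choice of der_zeta m by <:].
HB.instance Definition _ m := [SubChoice_isSubZmodule of der_zeta m by <:].

(** The direct sum of these groups over the degrees [k.+1], [k >= 0]. *)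
Definition der_family : nat -> zmodType := fun k => der_zeta k.+1.
Local Notation Der_plus_zeta := (dsum der_family).

Definition hom_act (f : F) (d : gr 1 -> Aplus) : gr 1 -> Aplus :=
  fun a => actp f (d (act f^-1%g a)).

Definition quasi_equivariant (d : gr 1 -> Aplus) : Prop :=
  forall f : F, exists v : Aplus,
    forall a : gr 1, hom_act f d a - d a = brp v (of_deg1 a).

Definition D1_pred : {pred gr 1 -> Aplus} := fun d =>
  `[< [/\ forall a b : gr 1, d (a + b) = d a + d b,
          quasi_equivariant d,
          forall a n, (n < 2)%N -> d a n = 0
        & d z = 0] >].

Let D1_closed : zmod_closed D1_pred.
Proof.
have EB (d e : gr 1 -> Aplus) a : (d - e) a = d a - e a by [].
have brpB (x y : Aplus) a : brp (x - y) a = brp x a - brp y a.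
  apply: dsumP => n; rewrite dsumB -[RHS]sumrB; apply: eq_bigr => i _.
  by rewrite dsumB brBl // subnKC // -ltnS.
have actpB f (x y : Aplus) : actp f (x - y) = actp f x - actp f y.
  by apply: dsumP => n; rewrite dsumB -[RHS]actB -dsumB.
split.
  apply/asboolP; split=> //.
  - by move=> a b; rewrite addr0.
  - move=> f; exists 0 => a; apply: dsumP => n.
    rewrite subr0 /= [LHS]act0 big1 // => i _.
    by apply: br0l; rewrite subnKC // -ltnS.
move=> d e /asboolP[d1 d2 d3 d4] /asboolP[e1 e2 e3 e4].
apply/asboolP; split.
- by move=> a b; rewrite !EB d1 e1 opprD addrACA.
- move=> f; have [v dv] := d2 f; have [u eu] := e2 f.
  exists (v - u) => a; rewrite brpB -dv -eu /hom_act !EB actpB.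
  by rewrite [in LHS]opprD addrACA -opprD.
- by move=> a n n2; rewrite EB dsumB d3 // e3 // subrr.
- by rewrite EB d4 e4 subrr.
Qed.
HB.instance Definition _ :=
  GRing.isZmodClosed.Build (gr 1 -> Aplus) D1_pred D1_closed.

Record D1_plus := D1Plus {
  D1_val : gr 1 -> Aplus;
  D1_valP : D1_val \in D1_pred }.
HB.instance Definition _ := [isSub for D1_val].
HB.instance Definition _ := [Choice of D1_plus by <:].
HB.instance Definition _ := [SubChoice_isSubZmodule of D1_plus by <:].

(** The degree [1] part of a sum of derivations: its component of degree [m.+1]
    comes from the summand of degree [m = k.+1]. *)
Let deg1_part_subproof (d : Der_plus_zeta) (a : gr 1) :
  exists N, forall n, (N <= n)%N ->
    match n return gr n with
    | k.+2 => (der_val (d k)).2 1%N a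
    | _ => 0
    end = 0.
Proof.
have [N dN] := dsum_finite d; exists N.+2.
by case=> [|[|k]] //; rewrite !ltnS => Nk; rewrite dN.
Qed.
Definition deg1_part (d : Der_plus_zeta) : gr 1 -> Aplus := fun a =>
  @mk_dsum gr_family
    (fun n => match n return gr n with
              | k.+2 => (der_val (d k)).2 1%N a
              | _ => 0
              end) (deg1_part_subproof d a).

End Zeta.

End ExtendedGradedLieAlgebra.

Notation Aplus w := (dsum (gr_family w)).
Notation Der_plus_zeta z := (dsum (der_family z)).

(* Main.v *)
From HB Require Import structures.
Require Import Defs.
From mathcomp Require Import all_boot all_algebra.
From mathcomp Require Import boolp classical_sets functions wochoice.
From mathcomp Require Import zify.

Set Implicit Arguments.
Unset Strict Implicit.
Unset Printing Implicit Defensive.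
Import GRing.Theory.

(** A derivation of positive degree is determined by [d_1]: the Lie ring
    [gr] is generated in degree 1, so [d_1 = 0] forces [d_i = 0] for [i >= 1],
    and then [[d_0 f, a] = 0] for every [a] of degree 1, which forces
    [d_0 = 0] because no nonzero element of [gr] commutes with degree 1
    ([gr_center]).  Conversely let [delta] be quasi-equivariant, with
    [f delta - delta = [v_f, -]].  Its homogeneous components extend to
    derivations of the Lie ring ([extend_derivation]), and [d_0 f := - v_f] is
    the only possible completion.  The compatibility of [d_i] with the action of
    [F] propagates from degree 1 to all degrees by the Jacobi identity, and the
    cocycle identity follows from [gr_center], as both sides have the same
    bracket with degree 1.  Only finitely many components survive: [F] is
    finitely generated and so is [gr 1] over [F], and a derivation vanishing on
    both sets of generators is zero ([derivation_gen_eq0]).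

    Two facts on the kernel [A] of [w] are behind this.  First, [A] is free on
    the conjugates of the meridians by a lift of [F] ([free_kernel]).  To send
    these conjugates to arbitrary elements of a group [H], one maps the free
    group [G] to the wreath product of [H] by [F].  Freeness gives at once the
    extension of [delta]: choose the endomorphism [psi] of [A] that multiplies
    each letter [x] by a representative of [delta [x]], and let [d_i] be induced
    by [x |-> psi x * x^-1], which is a derivation by commutator calculus.

    Second, [gr_center] holds.  The Magnus expansion maps
    [A] to power series in noncommuting letters, sends the [n]-th term of the
    lower central series to [1 + (terms of degree >= n)], and turns brackets
    into commutators, so that a central class has leading part zero: comparing
    the coefficients of [x :: s], for [x] distinct from the last letter of [s],
    kills each coefficient.  It remains to see that the leading part is
    injective on [gr n] ([lead_inj]), which is the theorem of Magnus and Witt.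
    This is proved with Lyndon words: the standard bracketings of the Lyndon
    words of length [n] span [gr n] ([lyn_span_all]), while the leading part of
    the bracketing of [s] is [s] plus words larger than [s], so that they are
    independent. *)

(** * The graded Lie ring of the lower central series *)

Section Graded.
Local Open Scope ring_scope.
Variables (G F : groupType) (w : {ghom G -> F}).
Local Notation A := (kernel w).
Local Notation Gam := (lcs (kernel w)).
Implicit Types (n m i j : nat).

Lemma Gam_subgroup n : subgroup (Gam n).
Proof. exact: lcs_subgroup (kernel_subgroup w). Qed.

Lemma Gam_normal n : normal (Gam n).
Proof. by apply: lcs_normal; [exact: kernel_subgroup|exact: kernel_normal]. Qed.

Lemma Gam_decr n x : Gam n.+1 x -> Gam n x.
Proof. by apply: lcs_decr; [exact: kernel_subgroup|exact: kernel_normal]. Qed.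

Lemma GamW n k x : Gam (n + k) x -> Gam n x.
Proof. by elim: k => [|k IH]; rewrite ?addn0 ?addnS // => /Gam_decr. Qed.

Lemma Gam_ker n x : Gam n x -> A x.
Proof. by apply: lcs_subA; [exact: kernel_subgroup|exact: kernel_normal]. Qed.

Lemma Gam_comm i j n x y : n = (i + j)%N ->
  Gam i x -> Gam j y -> Gam n [~ x, y]%g.
Proof.
by move=> ->; apply: lcs_comm; [exact: kernel_subgroup|exact: kernel_normal].
Qed.

Lemma gr_elim n (Q : gr w n -> Prop) :
  (forall x, Gam n x -> Q (cl w n x)) -> forall u, Q u.
Proof. by move=> h u; rewrite -[u]repK; apply: h; exact: repP. Qed.

Lemma clV n x : Gam n x -> cl w n x^-1%g = - cl w n x.
Proof.
move=> nx; apply/eqP; rewrite -addr_eq0 -clM ?mulVg //.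
exact: (subgroupV (Gam_subgroup n)).
Qed.

(** [A] acts trivially on the graded quotients, as [x ^ k = x * [~ x, k]]. *)
Lemma clJ n x k : Gam n x -> A k -> cl w n (x ^ k)%g = cl w n x.
Proof.
move=> nx kk; have -> : (x ^ k = x * [~ x, k])%g by rewrite commgEl mulVKg.
have c : Gam n.+1 [~ x, k]%g by apply: (@Gam_comm n 1); rewrite ?addn1.
by rewrite clM // ?(clS c) ?addr0 //; exact: Gam_decr.
Qed.

Lemma br_clE i j n x y : n = (i + j)%N -> Gam i x -> Gam j y ->
  br n (cl w i x) (cl w j y) = cl w n [~ x, y]%g.
Proof. by move=> ->; exact: br_cl. Qed.

Lemma brNl i j n (u : gr w i) (v : gr w j) : n = (i + j)%N ->
  br n (- u) v = - br n u v.
Proof. by move=> nE; rewrite -sub0r brBl // br0l // sub0r. Qed.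

Lemma brNr i j n (u : gr w i) (v : gr w j) : n = (i + j)%N ->
  br n u (- v) = - br n u v.
Proof. by move=> nE; rewrite -sub0r brBr // br0r // sub0r. Qed.

Lemma brxx i n (u : gr w i) : n = (i + i)%N -> br n u u = 0.
Proof.
move=> nE; elim/gr_elim: u => x ix; rewrite br_clE // commgg.
exact: cl1.
Qed.

(** The Hall-Witt identity read modulo the next term of the series. *)
Lemma jacobi i j k n (u : gr w i) (v : gr w j) (t : gr w k) :
  n = (i + j + k)%N ->
  br n (br (i + j) u v) t = br n u (br (j + k) v t) + br n (br (i + k) u t) v.
Proof.
move=> nE; elim/gr_elim: u => x ix; elim/gr_elim: v => y jy; elim/gr_elim: t => z kz.
have yV := subgroupV (Gam_subgroup j) jy; have xV := subgroupV (Gam_subgroup i) ix.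
have zV := subgroupV (Gam_subgroup k) kz.
have [xA yA zA] := And3 (Gam_ker ix) (Gam_ker jy) (Gam_ker kz).
have cycl a b c n' p q r : n' = (a + b + c)%N ->
    Gam a p -> Gam b q -> Gam c r -> A q ->
    Gam n' ([~ p, q^-1, r] ^ q)%g /\
    cl w n' ([~ p, q^-1, r] ^ q)%g =
      - br n' (br (a + b) (cl w a p) (cl w b q)) (cl w c r).
  move=> -> ap bq cr qA; have qV := subgroupV (Gam_subgroup b) bq.
  have pq : Gam (a + b) [~ p, q^-1]%g by exact: Gam_comm.
  have pqr : Gam (a + b + c) [~ p, q^-1, r]%g by exact: Gam_comm.
  split; first exact: Gam_normal.
  rewrite clJ // -(br_clE (erefl _) pq cr) -(br_clE (erefl _) ap qV) clV //.
  by rewrite brNr // brNl.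
have [g1 e1] := cycl _ _ _ n _ _ _ nE ix jy kz yA.
have nE2 : n = (j + k + i)%N by rewrite nE -addnA addnC.
have nE3 : n = (k + i + j)%N by rewrite nE2 -addnA addnC.
have [g2 e2] := cycl _ _ _ n _ _ _ nE2 jy kz ix zA.
have [g3 e3] := cycl _ _ _ n _ _ _ nE3 kz ix jy xA.
have := congr1 (cl w n) (Hall_Witt x y z).
rewrite clM //; last exact: (subgroupM (Gam_subgroup n)).
rewrite clM // e1 e2 e3 cl1 => /eqP; rewrite -!opprD oppr_eq0 => /eqP H.
set U := cl w i x in H *; set V := cl w j y in H *; set T := cl w k z in H *.
rewrite [br n U _]brC; last by rewrite nE addnA.
rewrite [br (i + k) U T]brC // [(i + k)%N]addnC brNl; last by rewrite nE3.
by apply/eqP; rewrite -opprD -addr_eq0 addrA H.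
Qed.

(** The Jacobi identity as the statement that [ad t] is a derivation. *)
Lemma br_leibniz i j k n p q r (t : gr w k) (u : gr w i) (v : gr w j) :
  n = (i + j + k)%N -> p = (i + k)%N -> q = (j + k)%N -> r = (i + j)%N ->
  br n (br p t u) v + br n u (br q t v) = br n t (br r u v).
Proof.
move=> nE pE qE rE; have nE' : n = (k + i + j)%N by rewrite nE addnC addnA.
have {}pE : p = (k + i)%N by rewrite pE addnC.
have {}qE : q = (k + j)%N by rewrite qE addnC.
subst p q r; rewrite jacobi // [X in _ + X = _]brC ?addrK //.
by rewrite nE' -addnA addnCA.
Qed.

(** Lifting [f] to [G] makes [act f] a conjugation, hence a morphism. *)
Lemma act_br i j n f (u : gr w i) (v : gr w j) : n = (i + j)%N ->
  (exists x, w x = f) ->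
  act f (br n u v) = br n (act f u) (act f v).
Proof.
move=> nE [x <-]; elim/gr_elim: u => y iy; elim/gr_elim: v => z jz.
have yz : Gam n [~ y, z]%g by exact: Gam_comm nE _ _.
rewrite br_clE // !act_cl // br_clE ?conjRg //; exact: Gam_normal.
Qed.

Lemma actM n f h (u : gr w n) : (exists x, w x = f) -> (exists x, w x = h) ->
  act (f * h)%g u = act f (act h u).
Proof.
move=> [x <-] [y <-]; elim/gr_elim: u => z nz.
rewrite -gmulfM !act_cl // ?invgM ?conjgM //; exact: Gam_normal.
Qed.

Lemma act1 n (u : gr w n) : act 1%g u = u.
Proof. by elim/gr_elim: u => z nz; rewrite -(gmulf1 (s := w)) act_cl // invg1 conjg1. Qed.

Lemma actK n f (u : gr w n) : (exists x, w x = f) ->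
  act f (act f^-1%g u) = u.
Proof.
move=> fx; rewrite -actM ?mulgV ?act1 //.
by case: fx => x <-; exists x^-1%g; rewrite gmulfV.
Qed.

Definition subzmod (V : zmodType) (P : V -> Prop) : Prop :=
  P 0 /\ forall x y, P x -> P y -> P (x - y).

(** Reduces statements on [gr n] to commutators, and for [n = 1] to letters. *)
Lemma cl_gen n (S : set G) (P : gr w n -> Prop) : subzmod P ->
  (gen S `<=` Gam n)%classic ->
  (forall x, S x -> P (cl w n x)) -> forall x, gen S x -> P (cl w n x).
Proof.
move=> [P0 PB] SG PS x Sx.
pose H := [set x | gen S x /\ P (cl w n x)]%classic.
suff : H x by case.
have sS := gen_subgroup S.
apply: (gen_sub (H := H)) Sx; last by move=> y Sy; split; [exact: sub_gen|exact: PS].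
split; first by split=> //; exact: sS.1.
move=> a b [Sa Pa] [Sb Pb]; split; first exact: sS.2.
have [Ga Gb] := conj (SG _ Sa) (SG _ Sb).
by rewrite clM ?clV //; [exact: PB|exact: (subgroupV (Gam_subgroup n))].
Qed.

(** [Gam n.+2] is generated by the commutators of [Gam n.+1] with [A], whence
    an induction on the degree: the Lie ring is generated in degree 1. *)
Lemma gr_ind1 (P : forall n, gr w n.+1 -> Prop) :
  (forall n, subzmod (@P n)) ->
  (forall u, P 0 u) ->
  (forall n u a, P n u -> P n.+1 (br n.+2 u (a : gr w 1))) ->
  forall n u, P n u.
Proof.
move=> Ps P1 PS; elim=> [//|n IH]; elim/gr_elim => x; rewrite lcsSS.
apply: cl_gen => // _ [y [z [ny Az ->]]].
have z1 : Gam 1 z by [].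
by rewrite -(@br_clE n.+1 1) ?addn1 //; exact: PS.
Qed.

End Graded.

(** * The kernel is free on the conjugates of the meridians *)
Section SubgroupType.
Local Open Scope group_scope.
Variables (G : groupType) (K : set G) (sK : subgroup K).

Let inK : {pred G} := fun x => `[< K x >].
Let inK_closed : group_closed inK.
Proof.
split; first by apply/asboolP; exact: sK.1.
by move=> x y /asboolP Kx /asboolP Ky; apply/asboolP; exact: sK.2.
Qed.

Let T : Type := {x : G | inK x}.
HB.instance Definition _ := SubChoice.on T.
HB.instance Definition _ := SubChoice_isSubGroup.Build G inK T inK_closed.

(** A basis generates: map [G] to the subgroup [K] by sending the basis to
    itself; composed with the inclusion this fixes the basis, so it is the
    identity of [G]. *)
Lemma free_basis_ind (I : Type) (b : I -> G) :
  free_basis b -> (forall i, K (b i)) -> forall x, K x.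
Proof.
move=> fb Kb x.
have [h hE] := (fb T (fun i => exist inK (b i) (asboolT (Kb i)))).1.
have := (fb G (fun i => b i)).2 (\val \o h : {ghom G -> G}) (idfun : {ghom G -> G}).
move=> /(_ _)/(_ x) /= <- => [|i]; last by rewrite /= hE.
exact/asboolP/(valP (h x)).
Qed.

End SubgroupType.

Section Wreath.
Local Open Scope group_scope.
Variables (F H : groupType).

(** The unrestricted wreath product of [H] by [F], in which [F] acts on the
    functions [F -> H] by right translation of the argument. *)
Definition wreath : Type := ((F -> H) * F)%type.
HB.instance Definition _ := gen_eqMixin wreath.
HB.instance Definition _ := gen_choiceMixin wreath.
Implicit Types p q : wreath.

Definition wreath_mul p q : wreath :=
  (fun f => p.1 f * q.1 (f * p.2), p.2 * q.2).
Definition wreath_one : wreath := (fun=> 1, 1).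
Definition wreath_inv p : wreath := (fun f => (p.1 (f * p.2^-1))^-1, p.2^-1).

Fact wreath_mulA : associative wreath_mul.
Proof.
move=> p q r; rewrite /wreath_mul /= mulgA; congr pair.
by apply/funext => f; rewrite !mulgA.
Qed.
Fact wreath_mul1 : left_id wreath_one wreath_mul.
Proof.
move=> [p f]; rewrite /wreath_mul /= mul1g; congr pair.
by apply/funext => h; rewrite mul1g mulg1.
Qed.
Fact wreath_1mul : right_id wreath_one wreath_mul.
Proof.
move=> [p f]; rewrite /wreath_mul /= mulg1; congr pair.
by apply/funext => h; rewrite mulg1.
Qed.
Fact wreath_mulV : left_inverse wreath_one wreath_inv wreath_mul.
Proof.
move=> [p f]; rewrite /wreath_mul /= mulVg; congr pair.
by apply/funext => h; rewrite mulVg.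
Qed.
Fact wreath_Vmul : right_inverse wreath_one wreath_inv wreath_mul.
Proof.
move=> [p f]; rewrite /wreath_mul /= mulgV; congr pair.
by apply/funext => h; rewrite mulgK mulgV.
Qed.
HB.instance Definition _ := isGroup.Build wreath
  wreath_mulA wreath_mul1 wreath_1mul wreath_mulV wreath_Vmul.

Lemma wreath_mul1E p q f : (p * q : wreath).1 f = p.1 f * q.1 (f * p.2).
Proof. by []. Qed.
Lemma wreath_mul2E p q : (p * q : wreath).2 = p.2 * q.2.
Proof. by []. Qed.
Lemma wreath_inv1E p f : (p^-1 : wreath).1 f = (p.1 (f * p.2^-1))^-1.
Proof. by []. Qed.
Lemma wreath_inv2E p : (p^-1 : wreath).2 = p.2^-1.
Proof. by []. Qed.
End Wreath.

(** [A] is freely generated by the [b x].  The group morphisms out of [A] are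
    encoded as functions on [G] that are multiplicative on [A]. *)
Definition free_subgroup (X : Type) (G : groupType) (A : set G) (b : X -> G) : Prop :=
  [/\ subgroup A, forall x, A (b x),
      (A `<=` gen [set b x | x in setT])%classic
    & forall (H : groupType) (f : X -> H), exists h : G -> H,
        (forall x y, A x -> A y -> h (x * y)%g = (h x * h y)%g) /\
        forall x, h (b x) = f x].

Section FreeKernel.
Local Open Scope group_scope.
Variables (I J : Type) (G F : groupType) (w : {ghom G -> F}).
Variables (alpha : I -> G) (beta : J -> G).
Hypothesis fG : free_basis (fun s : I + J =>
  match s with inl i => alpha i | inr j => beta j end).
Hypothesis fF : free_basis (fun j => w (beta j)).
Hypothesis w_alpha : forall i, w (alpha i) = 1.

Definition conj_letter (s : F -> G) (x : F * I) : G := alpha x.2 ^ (s x.1)^-1.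

Lemma ghom_section : exists s : {ghom F -> G},
  (forall j, s (w (beta j)) = beta j) /\ (forall f, w (s f) = f).
Proof.
have [s sE] := (fF beta).1; exists s; split=> // f.
pose K := [set f | w (s f) = f]%classic.
have sK : subgroup K.
  by split=> [|x y Kx Ky]; rewrite /K /= ?gmulf1 // !gmulfF Kx Ky.
by apply: (free_basis_ind sK fF) => j; rewrite /K /= sE.
Qed.

(** Modulo the subgroup generated by the letters, which is stable under the
    conjugations by [s f], every [x] is equal to [s (w x)]: it suffices to check
    this on the basis of [G]. *)
Lemma kernel_gen (s : {ghom F -> G}) : (forall j, s (w (beta j)) = beta j) ->
  (forall f, w (s f) = f) ->
  (kernel w `<=` gen [set conj_letter s x | x in setT])%classic.
Proof.
move=> sE ws; set B := gen _; have sB : subgroup B by exact: gen_subgroup.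
have BJ f x : B x -> B (x ^ (s f)^-1).
  apply: (gen_sub (H := [set x | B (x ^ (s f)^-1)]%classic)).
    exact: subgroup_conj.
  move=> _ [[h i] _ <-]; apply: sub_gen; exists (f * h, i) => //.
  by rewrite /conj_letter /= -conjgM gmulfM invgM.
have all x : B (x * (s (w x))^-1).
  pose K := [set x | B (x * (s (w x))^-1)]%classic.
  have sK : subgroup K.
    split=> [|x1 y Kx Ky]; rewrite /K /=; first by rewrite !gmulf1 mulgV; exact: sB.1.
    have := BJ (w x1 * (w y)^-1) _ Ky => /(subgroupV sB)/(subgroupM sB Kx).
    rewrite !gmulfF -!conjVg conjgE !invgM !invgK !mulgA.
    by rewrite !mulgVK.
  apply: (free_basis_ind sK fG) => -[i|j]; rewrite /K /=.
    rewrite w_alpha gmulf1 invg1 mulg1; apply: sub_gen; exists (1, i) => //.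
    by rewrite /conj_letter /= gmulf1 invg1 conjg1.
  by rewrite sE mulgV; exact: sB.1.
by move=> x wx; have := all x; rewrite wx gmulf1 invg1 mulg1.
Qed.

(** Send [alpha i] to the function [f |-> phi (f, i)] and [beta j] to
    [w (beta j)] in the wreath product.  Conjugation by [s f] translates the
    argument of functions by [f], so evaluation at 1 of the function part, a
    morphism on the kernel of [w], gives [phi (f, i)] on the letter [(f, i)]. *)
Lemma kernel_ext (s : {ghom F -> G}) (H : groupType) (phi : F * I -> H) :
  (forall j, s (w (beta j)) = beta j) ->
  exists h : G -> H,
    (forall x y, kernel w x -> kernel w y -> h (x * y) = h x * h y) /\
    (forall x, h (conj_letter s x) = phi x).
Proof.
move=> sE.
have [t tE] := (fG (fun k => match k with
  | inl i => ((fun f => phi (f, i), 1) : wreath F H)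
  | inr j => ((fun=> 1, w (beta j)) : wreath F H) end)).1.
have t2 x : (t x).2 = w x.
  pose K := [set x | (t x).2 = w x]%classic.
  have sK : subgroup K.
    split=> [|x1 y Kx Ky]; rewrite /K /=; first by rewrite !gmulf1.
    by rewrite !gmulfF wreath_mul2E wreath_inv2E Kx Ky.
  by apply: (free_basis_ind sK fG) => -[i|j]; rewrite /K /= ?(tE (inl _)) ?(tE (inr _)).
have ts f : t (s f) = (fun=> 1, f).
  pose K := [set f | t (s f) = (fun=> 1, f)]%classic.
  have sK : subgroup K.
    split=> [|x y Kx Ky]; rewrite /K /=; first by rewrite !gmulf1.
    rewrite !gmulfF Kx Ky; congr pair; apply/funext => h.
    by rewrite wreath_inv1E invg1 mulg1.
  by apply: (free_basis_ind sK fF) => j; rewrite /K /= sE (tE (inr _)).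
exists (fun x => (t x).1 1); split=> [x y wx wy|[f i]].
  by rewrite gmulfM wreath_mul1E t2 wx mulg1.
rewrite /conj_letter /= gmulfJ (tE (inl _)) gmulfV ts conjgE invgK.
by rewrite !(wreath_mul1E, wreath_inv1E) /= invg1 mulg1 !mul1g.
Qed.

Lemma free_kernel : exists b : F * I -> G, free_subgroup (kernel w) b /\
  (forall f i, exists2 x, w x = f & b (f, i) = alpha i ^ x^-1).
Proof.
have [s [sE ws]] := ghom_section; exists (conj_letter s); split; last first.
  by move=> f i; exists (s f).
split.
- exact: kernel_subgroup.
- by move=> [f i]; apply: kernel_normal; exact: w_alpha.
- exact: kernel_gen.
- by move=> H phi; exact: kernel_ext.
Qed.

End FreeKernel.

(** * Noncommutative power series *)

Section Series.
Local Open Scope ring_scope.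
Variable X : eqType.

Definition series : Type := seq X -> int.
HB.instance Definition _ := GRing.Zmodule.on series.
Implicit Types (p q r : series) (s t : seq X) (a : X).

Definition tail_series a p : series := fun s => p (a :: s).

(** The Cauchy product, by recursion on the word: the coefficient of [a :: s'] in
    [p * q] comes from the empty prefix, or from prefixes starting with [a].  The
    algebraic laws then follow by induction on the word. *)
Fixpoint conv p q s : int :=
  match s with
  | [::] => p [::] * q [::]
  | a :: s' => p [::] * q s + conv (tail_series a p) q s'
  end.

Definition mul_series p q : series := conv p q.
Definition one_series : series := fun s => (s == [::])%:R.
Definition letter_series a : series := fun s => (s == [:: a])%:R.

Lemma addsE p q s : (p + q) s = p s + q s. Proof. by []. Qed.
Lemma oppsE p s : (- p) s = - p s. Proof. by []. Qed.
Lemma subsE p q s : (p - q) s = p s - q s. Proof. by []. Qed.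

Fact mul_seriesDl : left_distributive mul_series +%R.
Proof.
move=> p q r; apply/funext; rewrite /mul_series => s; elim: s p q => [|a s IH] p q.
  exact: mulrDl.
have := IH (tail_series a p) (tail_series a q); rewrite !addsE /= addsE mulrDl => E.
by rewrite [conv (tail_series a (p + q)) r s]E addrACA.
Qed.
Fact mul_seriesDr : right_distributive mul_series +%R.
Proof.
move=> p q r; apply/funext; rewrite /mul_series => s; elim: s p => [|a s IH] p.
  exact: mulrDr.
have := IH (tail_series a p); rewrite !addsE /= addsE mulrDr => ->.
by rewrite addrACA.
Qed.
Lemma convZ (c : int) p q s : conv (fun t => c * p t) q s = c * conv p q s.
Proof.
elim: s p => [|a s IH] p /=; first by rewrite mulrA.
by rewrite mulrDr mulrA -IH.
Qed.
Lemma tail_mul a p q :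
  tail_series a (mul_series p q) =
    (fun s => p [::] * tail_series a q s) + mul_series (tail_series a p) q.
Proof. by []. Qed.
Fact mul_seriesA : associative mul_series.
Proof.
move=> p q r; apply/funext => s; elim: s p => [|a s IH] p /=; first exact: mulrA.
have := tail_mul a p q; rewrite /mul_series /= => ->.
rewrite -[conv (_ + _) r s]/(mul_series (_ + _) r s) mul_seriesDl addsE.
rewrite /mul_series convZ; have := IH (tail_series a p); rewrite /mul_series => <-.
by rewrite mulrDr mulrA addrA.
Qed.
Lemma conv0 q s : conv 0 q s = 0.
Proof. by elim: s => [|a s IH] /=; rewrite mul0r ?add0r. Qed.
Fact mul_series1l : left_id one_series mul_series.
Proof.
move=> p; apply/funext => -[|a s]; rewrite /mul_series /= mul1r //.
by rewrite [conv _ _ _](conv0 p s) addr0.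
Qed.
Fact mul_series1r : right_id one_series mul_series.
Proof.
move=> p; apply/funext; rewrite /mul_series => s; elim: s p => [|a s IH] p /=.
  by rewrite mulr1.
by rewrite IH mulr0 add0r.
Qed.
HB.instance Definition _ := GRing.Zmodule_isPzRing.Build series
  mul_seriesA mul_series1l mul_series1r mul_seriesDl mul_seriesDr.

Lemma one_series_pos s : (0 < size s)%N -> (1 : series) s = 0.
Proof. by case: s. Qed.

Lemma conv_cons p q a s :
  (p * q) (a :: s) = p [::] * q (a :: s) + (tail_series a p * q) s.
Proof. by []. Qed.
Lemma conv_nil p q : (p * q) [::] = p [::] * q [::].
Proof. by []. Qed.

Definition order_ge k p := forall s, (size s < k)%N -> p s = 0.

Lemma order_geD k p q : order_ge k p -> order_ge k q -> order_ge k (p + q).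
Proof. by move=> op oq s sk; rewrite addsE op // oq. Qed.

Lemma order_geN k p : order_ge k p -> order_ge k (- p).
Proof. by move=> op s sk; rewrite oppsE op // oppr0. Qed.

Lemma order_geB k p q : order_ge k p -> order_ge k q -> order_ge k (p - q).
Proof. by move=> op oq; apply: order_geD => //; exact: order_geN. Qed.

Lemma order_geM i j p q : order_ge i p -> order_ge j q -> order_ge (i + j) (p * q).
Proof.
move=> op oq s; elim: s i p op => [|a s IH] i p op.
  rewrite conv_nil; case: i op => [|i] op; last by rewrite op // mul0r.
  by move=> /oq ->; rewrite mulr0.
rewrite conv_cons; case: i op => [|i] op /= sij.
  by rewrite oq // mulr0 add0r; apply: (IH 0%N) => //; exact: ltnW.
by rewrite op // mul0r add0r; apply: (IH i) => // t ti; exact: op.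
Qed.

Lemma conv_lead i j p q s t : order_ge i p -> order_ge j q -> size s = i -> size t = j ->
  (p * q) (s ++ t) = p s * q t.
Proof.
move=> op oq; elim: s i p op => [|a s IH] i p op si tj; subst i.
  case: t tj => [//|b t] tj; rewrite conv_cons.
  have := @order_geM 0 j (tail_series b p) q; rewrite add0n => -> //; first by rewrite addr0.
  by rewrite -tj.
rewrite conv_cons (op [::]) // mul0r add0r.
by apply: (IH (size s)) => // u us; exact: op.
Qed.

Lemma letter_mul a p b s : (letter_series a * p) (b :: s) = (b == a)%:R * p s.
Proof.
rewrite conv_cons mul0r add0r.
have -> : tail_series b (letter_series a) = fun s => (b == a)%:R * one_series s.
  apply/funext => t; rewrite /tail_series /letter_series /one_series eqseq_cons.
  by rewrite -natrM mulnb.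
rewrite -[RHS]/(_ * _) -[p in RHS]mul1r; exact: convZ.
Qed.

Lemma mul_letter a p b s : (p * letter_series a) (rcons s b) = (b == a)%:R * p s.
Proof.
elim: s p => [|c s IH] p.
  rewrite /= conv_cons conv_nil mulr0 addr0 mulrC /letter_series.
  by rewrite eqseq_cons andbT.
rewrite rcons_cons conv_cons IH /letter_series eqseq_cons.
by case: s {IH} => [|d s]; rewrite andbF mulr0 add0r.
Qed.

(** The inverse of [1 + a]: the alternating sum of the powers of [a]. *)
Definition letter_inv a : series := fun s =>
  if all (pred1 a) s then (-1) ^+ size s else 0.

Lemma letter_invE a : letter_inv a = 1 - letter_series a * letter_inv a.
Proof.
apply/funext => -[|b s]; rewrite subsE.
  by rewrite conv_nil mul0r subr0.
rewrite letter_mul sub0r /letter_inv /=.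
by case: eqP => _ /=; [case: ifP|]; rewrite ?mul1r ?mul0r ?oppr0 // exprS mulN1r.
Qed.

Lemma letter_invEr a : letter_inv a = 1 - letter_inv a * letter_series a.
Proof.
apply/funext => s; case/lastP: s => [|s b]; rewrite subsE.
  by rewrite conv_nil mulr0 subr0.
rewrite mul_letter one_series_pos ?size_rcons // sub0r.
rewrite /letter_inv all_rcons size_rcons /=.
by case: eqP => _ /=; [case: ifP|]; rewrite ?mul1r ?mul0r ?oppr0 // exprS mulN1r.
Qed.

(** Carrying the inverse as a field dispenses with inverting a general series:
    only the inverses of the [1 + a] have to be written down. *)
Record unit_series := UnitSeries {
  us_val : series;
  us_inv : series;
  us_mulV : us_val * us_inv = 1;
  us_Vmul : us_inv * us_val = 1;
  us_nil : us_val [::] = 1 }.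
HB.instance Definition _ := gen_eqMixin unit_series.
HB.instance Definition _ := gen_choiceMixin unit_series.
Implicit Types (u v : unit_series).

Lemma us_eq u v : us_val u = us_val v -> u = v.
Proof.
case: u v => [p p' h1 h2 h3] [q q' k1 k2 k3] /= pq.
have pq' : p' = q' by rewrite -[p']mulr1 -k1 -pq mulrA h2 mul1r.
by rewrite {}pq {}pq' in h1 h2 h3 *; congr UnitSeries; exact: Prop_irrelevance.
Qed.

Fact us_one_subproof : (1 : series) * 1 = 1. Proof. exact: mulr1. Qed.
Definition us_one := @UnitSeries 1 1 us_one_subproof us_one_subproof (erefl _).

Program Definition us_mul u v :=
  @UnitSeries (us_val u * us_val v) (us_inv v * us_inv u) _ _ _.
Next Obligation. by rewrite mulrA -(mulrA (us_val u)) us_mulV mulr1 us_mulV. Qed.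
Next Obligation. by rewrite mulrA -(mulrA (us_inv v)) us_Vmul mulr1 us_Vmul. Qed.
Next Obligation. by rewrite conv_nil !us_nil. Qed.

Fact us_inv_nil u : us_inv u [::] = 1.
Proof.
have := congr1 (fun p : series => p [::]) (us_mulV u).
by rewrite conv_nil us_nil mul1r.
Qed.
Definition us_opp u := UnitSeries (us_Vmul u) (us_mulV u) (us_inv_nil u).

Fact us_mulA : associative us_mul.
Proof. by move=> u v z; apply: us_eq; rewrite /= mulrA. Qed.
Fact us_mul1l : left_id us_one us_mul.
Proof. by move=> u; apply: us_eq; rewrite /= mul1r. Qed.
Fact us_mul1r : right_id us_one us_mul.
Proof. by move=> u; apply: us_eq; rewrite /= mulr1. Qed.
Fact us_mulVl : left_inverse us_one us_opp us_mul.
Proof. by move=> u; apply: us_eq; rewrite /= us_Vmul. Qed.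
Fact us_mulVr : right_inverse us_one us_opp us_mul.
Proof. by move=> u; apply: us_eq; rewrite /= us_mulV. Qed.
HB.instance Definition _ := isGroup.Build unit_series
  us_mulA us_mul1l us_mul1r us_mulVl us_mulVr.

Lemma us_letter_mulV a : (1 + letter_series a) * letter_inv a = 1.
Proof. by rewrite mulrDl mul1r {1}letter_invE subrK. Qed.
Lemma us_letter_Vmul a : letter_inv a * (1 + letter_series a) = 1.
Proof. by rewrite mulrDr mulr1 {1}letter_invEr subrK. Qed.
Definition us_letter a :=
  @UnitSeries _ _ (us_letter_mulV a) (us_letter_Vmul a) (erefl _).

End Series.

(** * The Magnus expansion *)

Lemma mul_sub1 (R : pzRingType) (p q : R) :
  ((p - 1) * (q - 1) = p * q - (p + q) + 1)%R.
Proof.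
rewrite mulrBr mulr1 mulrBl mul1r opprB [(1 - p)%R]addrC addrA; congr (_ + _)%R.
by rewrite -addrA -opprD [(q + p)%R]addrC.
Qed.

Section Magnus.
Local Open Scope ring_scope.
Variables (X : eqType) (G F : groupType) (w : {ghom G -> F}) (b : X -> G).
Local Notation Gam := (lcs (kernel w)).
Variable mu : G -> unit_series X.
Hypothesis muM : forall x y, kernel w x -> kernel w y -> mu (x * y)%g = (mu x * mu y)%g.
Hypothesis mu_letter : forall a, mu (b a) = us_letter a.
Hypothesis bA : forall a, kernel w (b a).

Local Notation sA := (kernel_subgroup w).

Let mu1 : mu 1%g = 1%g.
Proof.
by apply: (mulgI (mu 1%g)); rewrite mulg1 -muM ?mulg1 //; exact: sA.1.
Qed.

Definition magnus x : series X := us_val (mu x).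

Lemma magnusM x y : kernel w x -> kernel w y ->
  magnus (x * y)%g = magnus x * magnus y.
Proof. by move=> Ax Ay; rewrite /magnus muM. Qed.

(** This is why commutators go to brackets: [[~ x, y]] differs from [1] by
    [(y * x)^-1 * (x * y - y * x)], and [1] commutes with everything. *)
Lemma magnus_comm x y : kernel w x -> kernel w y ->
  magnus [~ x, y]%g - 1 = magnus (y * x)^-1%g *
    ((magnus x - 1) * (magnus y - 1) - (magnus y - 1) * (magnus x - 1)).
Proof.
move=> Ax Ay; have Ayx := subgroupM sA Ay Ax; have Axy := subgroupM sA Ax Ay.
have -> : [~ x, y]%g = ((y * x)^-1 * (x * y))%g.
  by rewrite commgEl conjgE invgM !mulgA.
rewrite magnusM //; last exact: (subgroupV sA).
have -> : (magnus x - 1) * (magnus y - 1) - (magnus y - 1) * (magnus x - 1) =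
    magnus (x * y)%g - magnus (y * x)%g.
  rewrite !magnusM // !mul_sub1 [magnus y + magnus x]addrC.
  by rewrite [- (_ + 1)]opprD addrACA subrr addr0 opprB addrA subrK.
have Vyx := subgroupV sA Ayx.
by rewrite mulrBr -[X in _ = _ - X]magnusM // mulVg; congr (_ - _); rewrite /magnus mu1.
Qed.

Lemma order_ge0 (p : series X) : order_ge 0 p. Proof. by []. Qed.

Lemma magnus_ord n x : Gam n.+1 x -> order_ge n.+1 (magnus x - 1).
Proof.
elim: n x => [|n IH] x nx.
  by case=> // _; rewrite subsE /magnus us_nil subrr.
suff : [set x | kernel w x /\ order_ge n.+2 (magnus x - 1)]%classic x by case.
move: nx; rewrite lcsSS; apply: gen_sub.
  split; first by split; [exact: sA.1|rewrite /magnus mu1 subrr].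
  move=> y z [Ay oy] [Az oz]; split; first exact: sA.2.
  have Vz := subgroupV sA Az.
  have -> : magnus (y * z^-1)%g - 1 = ((magnus y - 1) - (magnus z - 1)) * magnus z^-1%g.
    rewrite opprB addrA subrK mulrBl -!magnusM // mulgV; congr (_ - _).
    by rewrite /magnus mu1.
  by have := @order_geM _ n.+2 0 _ _ (order_geB oy oz) (order_ge0 _); rewrite addn0; apply.
move=> _ [y [z [ny Az ->]]]; have Ay := Gam_ker ny; split.
  by apply: (Gam_ker (n := n.+2)); apply: (Gam_comm (i := n.+1) (j := 1)); rewrite ?addn1.
rewrite magnus_comm //; apply: (@order_geM _ 0 n.+2) => //.
have oy := IH _ ny; have oz : order_ge 1 (magnus z - 1).
  by case=> // _; rewrite subsE /magnus us_nil subrr.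
apply: order_geB; first by have := order_geM oy oz; rewrite addn1.
by have := order_geM oz oy; rewrite add1n.
Qed.

(** Only the coefficients of words of length [n] are meaningful for [u] in
    [gr n], as the others depend on the representative. *)
Definition lead n (u : gr w n) : series X := magnus (rep u) - 1.

Lemma lead_ord n (u : gr w n.+1) : order_ge n.+1 (lead u).
Proof. by apply: magnus_ord; exact: repP. Qed.

Lemma magnusM_lead n x y s : Gam n.+1 x -> Gam n.+1 y -> size s = n.+1 ->
  magnus (x * y)%g s = magnus x s + magnus y s.
Proof.
move=> nx ny sn; rewrite (magnusM (Gam_ker nx) (Gam_ker ny)).
have := magnus_ord nx; have := magnus_ord ny.
set p := magnus x; set q := magnus y => oq op.
have -> : p * q = (p - 1) * (q - 1) + (p + q - 1).
  by rewrite mul_sub1 addrACA subrK subrr addr0.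
rewrite addsE (order_geM op oq) ?add0r ?sn ?addSn ?addnS ?ltnS ?leq_addr //.
by rewrite !addsE oppsE one_series_pos ?sn // oppr0 addr0.
Qed.

Lemma lead_cl n x s : Gam n.+1 x -> size s = n.+1 -> lead (cl w n.+1 x) s = magnus x s.
Proof.
move=> nx sn; have [c cE] : exists2 c, Gam n.+2 c & rep (cl w n.+1 x) = (c * x)%g.
  by exists (rep (cl w n.+1 x) * x^-1)%g; [exact: rep_cl|rewrite mulgVK].
move=> rE; have s0 : (1 : series X) s = 0 by rewrite one_series_pos ?sn.
rewrite /lead rE subsE s0 subr0 (magnusM_lead (Gam_decr cE) nx sn).
have := magnus_ord cE => /(_ s); rewrite sn leqnn subsE s0 subr0 => -> //.
by rewrite add0r.
Qed.

Lemma leadB n (u v : gr w n.+1) s : size s = n.+1 ->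
  lead (u - v) s = lead u s - lead v s.
Proof.
move=> sn; apply/eqP; rewrite eq_sym subr_eq; apply/eqP; rewrite -{1}[u](subrK v).
elim/gr_elim: (u - v) => x nx; elim/gr_elim: v => y ny.
have nxy := subgroupM (Gam_subgroup w n.+1) nx ny.
by rewrite -clM // !lead_cl // (magnusM_lead nx ny sn).
Qed.

Lemma magnus_comm_lead i j x y s : Gam i.+1 x -> Gam j.+1 y ->
  size s = (i.+1 + j.+1)%N ->
  magnus [~ x, y]%g s =
    ((magnus x - 1) * (magnus y - 1) - (magnus y - 1) * (magnus x - 1)) s.
Proof.
move=> ix jy ss; have s0 : (1 : series X) s = 0 by rewrite one_series_pos ?ss.
rewrite -[LHS]subr0 -[X in _ - X]s0 -subsE.
rewrite (magnus_comm (Gam_ker ix) (Gam_ker jy)).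
set d := _ - _; set m := magnus _.
have [ox oy] := (magnus_ord ix, magnus_ord jy).
have od : order_ge (i.+1 + j.+1) d.
  by apply: order_geB; [exact: order_geM|rewrite addnC; exact: order_geM].
rewrite -[s]cat0s (@conv_lead _ 0 (i.+1 + j.+1)) //.
by rewrite /m /magnus us_nil mul1r.
Qed.

Lemma lead_br i j (u : gr w i.+1) (v : gr w j.+1) s : size s = (i.+1 + j.+1)%N ->
  lead (br (i.+1 + j.+1) u v) s = (lead u * lead v - lead v * lead u) s.
Proof.
move=> ss; have [ix jy] := (repP u, repP v).
rewrite -{1}[u]repK -{1}[v]repK br_clE // lead_cl //.
  by rewrite (magnus_comm_lead ix jy).
exact: Gam_comm ix jy.
Qed.

Lemma lead_letter a s : size s = 1 -> lead (cl w 1 (b a)) s = letter_series a s.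
Proof.
move=> s1; rewrite lead_cl //; last exact: bA.
by rewrite /magnus mu_letter /= addsE; case: s s1 => // c s _; rewrite add0r.
Qed.

(** If [p] commutes with the letter [x], the coefficient of [x :: s] in
    [x * p = p * x] is that of [s] in [p], and it is zero when [s] does not end
    with [x]; with two letters, such an [x] exists for each [s]. *)
Lemma lead_central n (u : gr w n.+1) (x1 x2 : X) : x1 != x2 ->
  (forall a, br n.+2 u (cl w 1 (b a)) = 0) -> forall s, size s = n.+1 -> lead u s = 0.
Proof.
move=> x12 uc s sn.
have comm a t : size t = n.+2 -> (lead u * letter_series a) t = (letter_series a * lead u) t.
  have oX : order_ge 1 (letter_series a) by case.
  move=> tn; have := @lead_br n 0 u (cl w 1 (b a)) t; rewrite addn1 => /(_ tn).
  rewrite uc.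
  have -> : lead (0 : gr w n.+2) t = 0 by rewrite -(subrr (0 : gr w n.+2)) leadB // subrr.
  move/esym/eqP; rewrite subsE subr_eq0 => /eqP.
  have oL := lead_ord u; have ol := lead_ord (cl w 1 (b a)).
  have e1 : size (take n.+1 t) = n.+1 by rewrite size_takel ?tn.
  have e2 : size (drop n.+1 t) = 1 by rewrite size_drop tn subSnn.
  have e3 : size (take 1 t) = 1 by rewrite size_takel ?tn.
  have e4 : size (drop 1 t) = n.+1 by rewrite size_drop tn subn1.
  have <- : (lead u * lead (cl w 1 (b a))) t = (lead u * letter_series a) t.
    rewrite -[t](cat_take_drop n.+1) (conv_lead oL ol e1 e2).
    by rewrite (conv_lead oL oX e1 e2) lead_letter.
  have <- // : (lead (cl w 1 (b a)) * lead u) t = (letter_series a * lead u) t.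
  rewrite -[t](cat_take_drop 1) (conv_lead ol oL e3 e4).
  by rewrite (conv_lead oX oL e3 e4) lead_letter.
have [x xs] : exists x, x != last x1 s.
  case: (eqVneq (last x1 s) x1) => [->|h]; first by exists x2; rewrite eq_sym.
  by exists x1; rewrite eq_sym.
have := comm x (x :: s); rewrite /= sn letter_mul eqxx mul1r => <- //.
case/lastP: s sn xs => [//|s y] _; rewrite last_rcons => xy.
by rewrite -rcons_cons mul_letter eq_sym (negbTE xy) mul0r.
Qed.

End Magnus.

(** * Lyndon words *)

Definition strict_well_order (X : eqType) (lt : rel X) : Prop :=
  [/\ irreflexive lt, transitive lt, forall a b, a != b -> lt a b || lt b a
    & forall P : X -> Prop, (exists a, P a) ->
        exists2 a, P a & forall b, P b -> ~~ lt b a].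

Lemma strict_well_order_ex (X : eqType) : exists lt : rel X, strict_well_order lt.
Proof.
have [R wR] := well_ordering_principle X.
have wT : wo_chain R predT by move=> A _; exact: wR.
have Rr := wo_chain_reflexive wT; have Ra := wo_chain_antisymmetric wT.
have Rt := wo_chainW wT.
have wf (P : X -> Prop) : (exists a, P a) -> exists2 a, P a & forall b, P b -> R a b.
  move=> [a Pa]; have [|z [[Pz lz] _]] := wR (fun x => `[< P x >]).
    by exists a; apply/asboolP.
  by exists z => [|b Pb]; [exact/asboolP|apply: lz; apply/asboolP].
exists (fun a b => R a b && (a != b)); split.
- by move=> a; rewrite eqxx andbF.
- move=> b a c /andP[ab nab] /andP[bc nbc].
  (* Look for the smallest element of [{a, b, c}]: it has to be [a]. *)
  have [x [-> | [-> | ->]] mx] := wf (fun x => x = a \/ (x = b \/ x = c))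
    (ex_intro _ a (or_introl (erefl a))).
  + rewrite mx; last by right; right.
    apply: contra_neq nab => ac; apply: Ra => //; by rewrite ab ac bc.
  + have ba : R b a by apply: mx; left.
    by case/eqP: nab; apply: Ra => //; rewrite ab ba.
  + have cb : R c b by apply: mx; right; left.
    by case/eqP: nbc; apply: Ra => //; rewrite bc cb.
- by move=> a b nab; rewrite (eq_sym b a) nab !andbT; exact: Rt.
- move=> P /wf[a Pa ma]; exists a => // b Pb; apply/negP => /andP[ba nba].
  by case/eqP: nba; apply: Ra => //; rewrite ba ma.
Qed.

Section LyndonWords.
Variables (X : eqType) (lt : rel X).
Hypothesis lt_wo : strict_well_order lt.
Implicit Types (a c : X) (p s t u v z : seq X).

Let lt_irr : irreflexive lt. Proof. by case: lt_wo. Qed.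
Let lt_trans : transitive lt. Proof. by case: lt_wo. Qed.

Fixpoint lexlt s t : bool :=
  match s, t with
  | _, [::] => false
  | [::], _ :: _ => true
  | a :: s', c :: t' => lt a c || (a == c) && lexlt s' t'
  end.

Lemma lexlt_irr s : lexlt s s = false.
Proof. by elim: s => //= a s ->; rewrite lt_irr eqxx. Qed.

Lemma lexlt_trans : transitive lexlt.
Proof.
move=> t s u; elim: s t u => [|a s IH] [|c t] [|d u] //=.
case/orP=> [ac|/andP[/eqP-> st]] /orP[cd|/andP[/eqP<- tu]].
- by rewrite (lt_trans ac cd).
- by rewrite ac.
- by rewrite cd.
- by rewrite eqxx (IH _ _ st tu) orbT.
Qed.

Lemma lexlt_total s t : s != t -> lexlt s t || lexlt t s.
Proof.
elim: s t => [|a s IH] [|c t] //=; rewrite eqseq_cons eq_sym negb_and.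
have [<-|ca] := eqVneq c a; first by rewrite lt_irr /=; exact: IH.
have [_ _ tot _] := lt_wo.
by move=> _; case/orP: (tot _ _ ca) => ->; rewrite ?orbT.
Qed.

Lemma lexlt_asym s t : lexlt s t -> lexlt t s -> False.
Proof. by move=> st ts; have := lexlt_trans st ts; rewrite lexlt_irr. Qed.

Lemma lexlt_cat2l p s t : lexlt (p ++ s) (p ++ t) = lexlt s t.
Proof. by elim: p => //= a p ->; rewrite lt_irr eqxx. Qed.

Lemma lexlt_prefix s z : z != [::] -> lexlt s (s ++ z).
Proof. by move=> z0; rewrite -[X in lexlt X]cats0 lexlt_cat2l; case: z z0. Qed.

(** Either [u] is a prefix of [v], or the comparison is decided at a common
    position and is insensitive to what follows. *)
Lemma lexlt_catP u v : lexlt u v ->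
  (exists2 z, z != [::] & v = u ++ z) \/ (forall s t, lexlt (u ++ s) (v ++ t)).
Proof.
elim: u v => [|a u IH] [|c v] //=; first by move=> _; left; exists (c :: v).
case/orP=> [ac|/andP[/eqP-> /IH[[z z0 ->]|h]]].
- by right=> s t; rewrite ac.
- by left; exists z.
- by right=> s t; rewrite eqxx h orbT.
Qed.

Lemma lexlt_cat_size u v s t : size u = size v ->
  lexlt (u ++ s) (v ++ t) = lexlt u v || (u == v) && lexlt s t.
Proof.
elim: u v => [|a u IH] [|c v] //= [uv]; rewrite IH // eqseq_cons.
by rewrite -orbA -andbA andb_orr.
Qed.

(** The lexicographic order is not well-founded in general ([b], [ab], [aab] and
    so on decrease), but it is so on words of bounded length. *)
Lemma lexlt_min n (P : seq X -> Prop) :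
  (exists2 s, P s & (size s <= n)%N) ->
  exists s, [/\ P s, (size s <= n)%N &
    forall t, P t -> (size t <= n)%N -> ~~ lexlt t s].
Proof.
elim: n P => [|n IH] P [s Ps sn].
  by case: s sn Ps => // _ P0; exists [::]; split=> // -[].
have [P0|nP0] := EM (P [::]); first by exists [::]; split=> // -[].
have [_ _ _ wf] := lt_wo.
have [|a [s' Ps' s'n] ma] := wf (fun a => exists2 s', P (a :: s') & (size s' <= n)%N).
  by case: s Ps sn => [//|a s' Ps sn]; exists a, s'.
have [|t [Pt tn mt]] := IH (fun s' => P (a :: s')); first by exists s'.
exists (a :: t); split=> // -[//|c r] Pcr rn /=.
rewrite negb_or ma /=; last by exists r.
by rewrite negb_and; have [E|//] := eqVneq c a; rewrite mt // -E.
Qed.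

Lemma lexlt_ind n (P : seq X -> Prop) :
  (forall s, (size s <= n)%N ->
    (forall t, (size t <= n)%N -> lexlt t s -> P t) -> P s) ->
  forall s, (size s <= n)%N -> P s.
Proof.
move=> IH s sn; apply: contrapT => nPs.
have [|t [nPt tn mt]] := @lexlt_min n (fun t => ~ P t); first by exists s.
apply: nPt; apply: IH => // r rn rt; apply: contrapT => nPr.
by have := mt r nPr rn; rewrite rt.
Qed.

Definition lyndon s : Prop :=
  s != [::] /\ forall p t, s = p ++ t -> p != [::] -> t != [::] -> lexlt s t.

Lemma lyndon_letter a : lyndon [:: a].
Proof. by split=> // -[//|c [|d p]] [|e t]. Qed.

Lemma cat_eq_cat p t u v : p ++ t = u ++ v ->
  (exists r, p = u ++ r /\ v = r ++ t) \/ (exists r, u = p ++ r /\ t = r ++ v).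
Proof.
elim: p u => [|a p IH] [|c u] /=.
- by move=> ->; left; exists [::].
- by move=> ->; right; exists (c :: u).
- by move=> <-; left; exists (a :: p).
- case=> -> /IH[[r [-> ->]]|[r [-> ->]]]; [left|right]; by exists r.
Qed.

Lemma cat_ltr u v : lyndon v -> lexlt u v -> u != [::] -> lexlt (u ++ v) v.
Proof.
move=> [v0 lv] uv u0; have [[z z0 vE]|] := lexlt_catP uv; last by move/(_ v [::]); rewrite cats0.
by rewrite {2}vE lexlt_cat2l (lv u z).
Qed.

(** A suffix is shorter than the word, which is therefore not one of its
    prefixes, and the comparison of the two is unaffected by appending [u]. *)
Lemma lyndon_suffix u r s : lyndon (r ++ s) -> r != [::] -> s != [::] ->
  lexlt ((r ++ s) ++ u) (s ++ u).
Proof.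
move=> [_ l] r0 s0; have [[z _ /(congr1 size)]|] := lexlt_catP (l r s (erefl _) r0 s0).
  by rewrite !size_cat => E; move: r0; rewrite -size_eq0; lia.
exact.
Qed.

Lemma lyndon_cat u v : lyndon u -> lyndon v -> lexlt u v -> lyndon (u ++ v).
Proof.
move=> lu lv uv; have uvv := cat_ltr lv uv lu.1.
split=> [|p t E p0 t0]; first by case: u lu {uv uvv} => [[]|].
have [[r [pE vE]]|[r [uE tE]]] := cat_eq_cat (esym E).
  have [r0|r0] := eqVneq r [::]; first by rewrite vE r0 in uvv *.
  by apply: (lexlt_trans uvv); exact: lv.2 vE r0 t0.
have [r0|r0] := eqVneq r [::]; first by rewrite tE r0.
by rewrite tE uE; apply: lyndon_suffix; rewrite -?uE.
Qed.

Definition min_suffix s v : Prop :=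
  forall p t, s = p ++ t -> p != [::] -> t != [::] -> ~~ lexlt t v.

(** Take for [v] the smallest proper suffix of [s].  If [u = p ++ t] with
    [t < u], then, since [s < t ++ v], [t] is a prefix of [u = t ++ z] and
    [z ++ v] is a proper suffix of [s] smaller than [v], a contradiction. *)
Lemma standard_factorization s : lyndon s -> (1 < size s)%N ->
  exists u v, [/\ s = u ++ v, lyndon u, lyndon v, lexlt u v & min_suffix s v].
Proof.
move=> ls s1.
pose P t := t != [::] /\ exists2 p, p != [::] & s = p ++ t.
have [|v [[v0 [u u0 sE]] _ mv]] := @lexlt_min (size s) P.
  case: s ls s1 @P => [//|a s] _ s1 P; exists s; last exact: leqnSn.
  by split; [case: s s1 {P}|exists [:: a]].
have {}mv t : P t -> ~~ lexlt t v.
  move=> Pt; apply: mv => //; case: Pt => _ [p _ ->].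
  by rewrite size_cat leq_addl.
have svv : lexlt s v by exact: ls.2 sE u0 v0.
exists u, v; split=> //.
- split=> // p t uE p0 t0; have lt1 : lexlt s (t ++ v).
    apply: (ls.2 p) => //; first by rewrite sE uE catA.
    by case: t t0 {uE}.
  rewrite sE in lt1; have [ut|] := eqVneq u t.
    by move: p0; rewrite -size_eq0; move/(congr1 size): uE; rewrite -ut size_cat; lia.
  move/lexlt_total => /orP[//|tu].
  have [[z z0 uz]|h] := lexlt_catP tu; last by case: (lexlt_asym lt1 (h v v)).
  move: lt1; rewrite uz -catA lexlt_cat2l => zv.
  have : P (z ++ v).
    split; first by case: z z0 {uz zv}.
    by exists t => //; rewrite sE uz catA.
  by move/mv; rewrite zv.
- split=> // p t vE p0 t0; have := mv t; rewrite /P t0 => /(_ _)/negP tv.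
  have {}tv : ~ lexlt t v.
    apply: tv; split=> //; exists (u ++ p); first by case: u u0 {sE}.
    by rewrite sE vE catA.
  have vt : v != t.
    by apply/eqP => /(congr1 size); move: p0; rewrite vE size_cat -size_eq0; lia.
  by case/orP: (lexlt_total vt).
- apply: (@lexlt_trans s) => //; rewrite sE; exact: lexlt_prefix.
- by move=> p t E p0 t0; apply: mv; split=> //; exists p.
Qed.

(** The condition under which [u ++ v] is the standard factorization of the
    product. *)
Lemma min_suffix_cat u v : lyndon v ->
  (size u = 1 \/ min_suffix u v) -> min_suffix (u ++ v) v.
Proof.
move=> lv h p t E p0 t0.
have [[r [pE vE]]|[r [uE tE]]] := cat_eq_cat (esym E).
  have [r0|r0] := eqVneq r [::]; first by rewrite vE r0 lexlt_irr.
  by apply/negP => tv; apply: (lexlt_asym tv); exact: lv.2 vE r0 t0.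
have [r0|r0] := eqVneq r [::]; first by rewrite tE r0 lexlt_irr.
rewrite tE; case: h => [u1|ms].
  by move: u1 p0 r0; rewrite uE size_cat -!size_eq0; lia.
apply/negP => rvv; have := ms p r uE p0 r0; move/negP; apply.
by apply: lexlt_trans rvv; apply: lexlt_prefix; exact: lv.1.
Qed.

Lemma min_suffix_uniq s u v u' v' : s = u ++ v -> s = u' ++ v' ->
  u != [::] -> v != [::] -> u' != [::] -> v' != [::] ->
  min_suffix s v -> min_suffix s v' -> u = u' /\ v = v'.
Proof.
move=> E E' u0 v0 u0' v0' m m'.
have vv : v = v'.
  apply/eqP; apply: contraT => /lexlt_total; rewrite (negbTE (m' _ _ E u0 v0)).
  by rewrite (negbTE (m _ _ E' u0' v0')).
split=> //; move: E; rewrite E' -vv => E; have := congr1 size E; rewrite !size_cat.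
by move/addIn => uu; move/eqP: E; rewrite eqseq_cat // => /andP[/eqP->].
Qed.

End LyndonWords.

(** * Lyndon words span the graded Lie ring *)

Section LyndonBasis.
Local Open Scope ring_scope.
Variables (X : eqType) (lt : rel X).
Hypothesis lt_wo : strict_well_order lt.
Variables (G F : groupType) (w : {ghom G -> F}) (b : X -> G).
Hypothesis bA : forall x, kernel w (b x).
Hypothesis bgen : (kernel w `<=` gen [set b x | x in setT])%classic.
Implicit Types (s t u v : seq X).
Local Notation Gam := (lcs (kernel w)).
Local Notation "s <l t" := (lexlt lt s t) (at level 70).
Local Notation lyn := (lyndon lt).

(** The standard bracketing is the graph of a function on Lyndon words, defined
    as a relation because the recursion is on the standard factorization. *)
Inductive bracketing : seq X -> G -> Prop :=
| BracketLetter x : bracketing [:: x] (b x)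
| BracketPair u v gu gv : lyn u -> lyn v -> u <l v ->
    (size u = 1 \/ min_suffix lt u v) ->
    bracketing u gu -> bracketing v gv -> bracketing (u ++ v) [~ gu, gv]%g.

Lemma size_lyn u : lyn u -> (0 < size u)%N.
Proof. by case=> u0 _; rewrite lt0n size_eq0. Qed.

Lemma bracketing_Gam s g : bracketing s g -> Gam (size s) g.
Proof.
elim=> [x|u v gu gv lu lv uv _ _ Iu _ Iv]; first exact: bA.
by rewrite size_cat; exact: Gam_comm.
Qed.

Lemma bracketing_ex s : lyn s -> exists g, bracketing s g.
Proof.
have [n] := ubnP (size s); elim: n s => // n IH s sn ls.
have [s1|s1] := leqP (size s) 1.
  by case: s ls s1 {sn} => [[]|x [|y s]] // _ _; exists (b x); constructor.
have [u [v [sE lu lv uv mv]]] := standard_factorization lt_wo ls s1.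
have := size_lyn lu; have := size_lyn lv.
move: sn; rewrite {1}sE size_cat => sn v0 u0.
have [gu bu] := IH u ltac:(lia) lu; have [gv bv] := IH v ltac:(lia) lv.
exists [~ gu, gv]%g; rewrite sE; constructor => //.
have [u1|u1] := leqP (size u) 1; first by left; lia.
right=> p t uE p0 t0; apply/negP => tv.
have := mv p (t ++ v); rewrite sE uE catA => /(_ (erefl _) p0) /(_ _)/negP.
by apply; [case: t t0 {uE tv}|apply: (cat_ltr lt_wo)].
Qed.

Lemma bracketing_uniq s g h : bracketing s g -> bracketing s h -> g = h.
Proof.
move=> bg; elim: bg h => [x|u v gu gv lu lv uv hu _ IHu _ IHv] h.
  move E: [:: x] => s' bh; case: bh E => [y [->]//|u v gu gv lu lv _ _ _ _ /(congr1 size)].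
  by rewrite size_cat /=; have := size_lyn lu; have := size_lyn lv; lia.
move E: (u ++ v) => s' bh; case: bh E => [y|u' v' gu' gv' lu' lv' uv' hu' bu' bv'] E.
  by move/(congr1 size): E; rewrite size_cat /=; have := size_lyn lu; have := size_lyn lv; lia.
have [] := @min_suffix_uniq _ lt lt_wo (u ++ v) u v u' v'; rewrite ?lu.1 ?lv.1 ?lu'.1 ?lv'.1 //.
- exact: min_suffix_cat.
- by rewrite E; exact: min_suffix_cat.
by move=> uE vE; rewrite -uE in bu'; rewrite -vE in bv'; rewrite (IHu _ bu') (IHv _ bv').
Qed.

Definition lyndon_bracket s : G := xget 1%g (bracketing s).

Lemma lyndon_bracketP s : lyn s -> bracketing s (lyndon_bracket s).
Proof. by move=> /bracketing_ex[g bg]; apply: (xgetPex 1%g); exists g. Qed.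

Lemma lyndon_bracket_cat u v : lyn u -> lyn v -> u <l v ->
  (size u = 1 \/ min_suffix lt u v) ->
  lyndon_bracket (u ++ v) = [~ lyndon_bracket u, lyndon_bracket v]%g.
Proof.
move=> lu lv uv h; apply: (@bracketing_uniq (u ++ v)).
  by apply: lyndon_bracketP; exact: lyndon_cat.
by constructor => //; exact: lyndon_bracketP.
Qed.

Lemma lyndon_bracket_letter x : lyndon_bracket [:: x] = b x.
Proof.
apply: (@bracketing_uniq [:: x]); last by constructor.
by apply: lyndon_bracketP; exact: lyndon_letter.
Qed.

Lemma lyndon_bracket_Gam s : lyn s -> Gam (size s) (lyndon_bracket s).
Proof. by move=> ls; apply: bracketing_Gam; exact: lyndon_bracketP. Qed.

Definition lyn_class n s : gr w n := cl w n (lyndon_bracket s).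

(** Keeping track of [Q] is what makes the induction of [lyn_span_bracket] work:
    it is used with [Q s := s < v], and dropped in the end. *)
Definition lyn_span n (Q : seq X -> Prop) (x : gr w n) : Prop :=
  exists l : seq (int * seq X),
    (forall p, p \in l -> [/\ lyn p.2, size p.2 = n & Q p.2]) /\
    x = \sum_(p <- l) lyn_class n p.2 *~ p.1.

Lemma lyn_span0 n Q : @lyn_span n Q 0.
Proof. by exists [::]; rewrite big_nil. Qed.

Lemma lyn_spanN n Q x : @lyn_span n Q x -> lyn_span Q (- x).
Proof.
move=> [l [lP ->]]; exists [seq (- p.1, p.2) | p <- l]; split.
  by move=> p /mapP[q ql ->]; exact: (lP q ql).
by rewrite big_map -sumrN; apply: eq_bigr => p _; rewrite mulrNz.
Qed.

Lemma lyn_spanD n Q x y : @lyn_span n Q x -> lyn_span Q y -> lyn_span Q (x + y).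
Proof.
move=> [l [lP ->]] [k [kP ->]]; exists (l ++ k); split; last by rewrite big_cat.
by move=> p; rewrite mem_cat => /orP[]; [exact: lP|exact: kP].
Qed.

Lemma lyn_spanZ n Q x (c : int) : @lyn_span n Q x -> lyn_span Q (x *~ c).
Proof.
move=> [l [lP ->]]; exists [seq (p.1 * c, p.2) | p <- l]; split.
  by move=> p /mapP[q ql ->]; exact: (lP q ql).
by rewrite big_map mulrz_suml; apply: eq_bigr => p _; rewrite mulrzA.
Qed.

Lemma lyn_span_sub n Q : subzmod (@lyn_span n Q).
Proof.
by split=> [|x y hx hy]; [exact: lyn_span0|apply: lyn_spanD => //; exact: lyn_spanN].
Qed.

Lemma lyn_spanS n (Q Q' : seq X -> Prop) x : (forall s, Q s -> Q' s) ->
  @lyn_span n Q x -> lyn_span Q' x.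
Proof. by move=> QQ [l [lP xE]]; exists l; split=> // p /lP[? ? /QQ]. Qed.

Lemma lyn_span_class n (Q : seq X -> Prop) s : lyn s -> size s = n -> Q s ->
  lyn_span Q (lyn_class n s).
Proof.
move=> ls sn Qs; exists [:: (1, s)]; split; last by rewrite big_seq1.
by move=> p; rewrite inE => /eqP->.
Qed.

Lemma lyn_span_brl m k n (Q Q' : seq X -> Prop)
    (x : gr w m) (y : gr w k) :
  n = (m + k)%N ->
  (forall s, lyn s -> size s = m -> Q s -> lyn_span Q' (br n (lyn_class m s) y)) ->
  lyn_span Q x -> lyn_span Q' (br n x y).
Proof.
move=> nE h [l [lP ->]]; elim: l lP => [|p l IH] lP.
  by rewrite big_nil br0l //; exact: lyn_span0.
rewrite big_cons brDl //; apply: lyn_spanD; last first.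
  by apply: IH => q ql; apply: lP; rewrite inE ql orbT.
have [l1 l2 l3] := lP p (mem_head _ _).
have -> : br n (lyn_class m p.2 *~ p.1) y = br n (lyn_class m p.2) y *~ p.1.
  have brn c : br n (lyn_class m p.2 *+ c) y = br n (lyn_class m p.2) y *+ c.
    by elim: c => [|c IHc]; rewrite ?mulr0n ?br0l // !mulrS brDl // IHc.
  by case: (p.1) => c; rewrite ?NegzE ?mulrNz ?brNl // -!pmulrn brn.
by apply: lyn_spanZ; exact: h.
Qed.

Lemma lyn_span_brr m k n (Q Q' : seq X -> Prop)
    (x : gr w m) (y : gr w k) :
  n = (m + k)%N ->
  (forall s, lyn s -> size s = k -> Q s -> lyn_span Q' (br n x (lyn_class k s))) ->
  lyn_span Q y -> lyn_span Q' (br n x y).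
Proof.
move=> nE h Qy; rewrite brC //; apply: lyn_spanN.
apply: lyn_span_brl Qy; first by rewrite addnC.
move=> s ls sk Qs; rewrite brC 1?addnC //; apply: lyn_spanN; exact: h.
Qed.

(** By induction on the total length, then on the larger word [v].  If
    [u ++ v] is a standard factorization, the bracket is the bracketing of
    [u ++ v < v].  Otherwise [u = u' ++ u''] is standard with [u'' < v], and
    [[[u', u''], v] = [u', [u'', v]] + [[u', v], u'']].  The inner brackets are
    shorter, so they are combinations of words smaller than [v]; as [u' < u'' < v]
    too, the outer brackets only involve words smaller than [v]. *)
Lemma lyn_span_bracket n u v : lyn u -> lyn v -> u <l v -> n = (size u + size v)%N ->
  lyn_span (fun s => s <l v) (br n (lyn_class (size u) u) (lyn_class (size v) v)).
Proof.
elim/ltn_ind: n u v => n IHn u v lu lv uv nE.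
have vn : (size v <= n)%N by rewrite nE leq_addl.
move: v vn u lu lv uv nE; apply: (lexlt_ind lt_wo) => v vn IHv u lu lv uv nE.
(* By antisymmetry the two words may be put in increasing order. *)
have sub u1 u2 : lyn u1 -> lyn u2 -> u1 <l v -> u2 <l v -> n = (size u1 + size u2)%N ->
    lyn_span (fun s => s <l v) (br n (lyn_class (size u1) u1) (lyn_class (size u2) u2)).
  move=> l1 l2 u1v u2v n12; have [E|] := eqVneq u1 u2.
    by rewrite E in n12 *; rewrite brxx //; exact: lyn_span0.
  have wk t : t <l v -> forall s, s <l t -> s <l v.
    by move=> tv s st; exact: (lexlt_trans lt_wo st).
  case/(lexlt_total lt_wo)/orP => uu.
    by apply: (lyn_spanS (wk _ u2v)); apply: IHv => //; lia.
  rewrite brC //; apply: lyn_spanN; apply: (lyn_spanS (wk _ u1v)).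
  by apply: IHv => //; lia.
have std : (size u = 1 \/ min_suffix lt u v) ->
    lyn_span (fun s => s <l v) (br n (lyn_class (size u) u) (lyn_class (size v) v)).
  move=> h; rewrite br_clE //; try exact: lyndon_bracket_Gam.
  rewrite -lyndon_bracket_cat //; apply: lyn_span_class; first exact: lyndon_cat.
    by rewrite size_cat.
  exact: (cat_ltr lt_wo lv uv lu.1).
have [u1|u1] := leqP (size u) 1; first by apply: std; left; have := size_lyn lu; lia.
have [ms|nms] := EM (min_suffix lt u v); first by apply: std; right.
have [u' [u'' [uE lu' lu'' uu mu]]] := standard_factorization lt_wo lu u1.
have [s1 s2 s3] := And3 (size_lyn lu') (size_lyn lu'') (size_lyn lv).
have u''v : u'' <l v.
  apply: contrapT => h; apply: nms => p t E p0 t0; apply/negP => tv.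
  have := mu _ _ E p0 t0; apply/negP; rewrite negbK.
  have [tu|] := eqVneq u'' t; first by rewrite tu in h.
  move/(lexlt_total lt_wo) => /orP[ut|//].
  by case: h; exact: (lexlt_trans lt_wo ut).
have u'v : u' <l v := lexlt_trans lt_wo uu u''v.
have stdu : (size u' = 1 \/ min_suffix lt u' u'').
  have [k1|k1] := leqP (size u') 1; first by left; lia.
  right=> p t E p0 t0; apply/negP => tu.
  have := mu p (t ++ u''); rewrite uE E catA => /(_ (erefl _) p0) /(_ _)/negP.
  by apply; [case: t t0 {E tu}|apply: (cat_ltr lt_wo)].
have su : size u = (size u' + size u'')%N by rewrite uE size_cat.
have -> : lyn_class (size u) u =
    br (size u) (lyn_class (size u') u') (lyn_class (size u'') u'').
  rewrite (br_clE su (lyndon_bracket_Gam lu') (lyndon_bracket_Gam lu'')).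
  rewrite -lyndon_bracket_cat //.
  by rewrite -uE.
rewrite su jacobi -?su //; apply: lyn_spanD.
  apply: (@lyn_span_brr _ _ _ (fun s => s <l v)); first by rewrite nE su addnA.
    move=> s ls ss sv; rewrite -ss; apply: sub => //; lia.
  by apply: IHn => //; lia.
apply: (@lyn_span_brl _ _ _ (fun s => s <l v)); first by lia.
  move=> s ls ss sv; rewrite -ss; apply: sub => //; lia.
by apply: IHn => //; lia.
Qed.

Lemma lyn_span_all n (u : gr w n.+1) : lyn_span (fun=> True) u.
Proof.
have deg1 (a : gr w 1) : lyn_span (fun=> True) a.
  elim/gr_elim: a => x /bgen; apply: cl_gen; first exact: lyn_span_sub.
    apply: gen_sub; first exact: Gam_subgroup.
    by move=> _ [y _ <-]; exact: bA.
  move=> _ [y _ <-]; rewrite -lyndon_bracket_letter.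
  by apply: lyn_span_class => //; exact: lyndon_letter.
move: n u; apply: gr_ind1 => [n|//|n u a uS]; first exact: lyn_span_sub.
have aS := deg1 a.
apply: lyn_span_brl uS; first by rewrite addn1.
move=> s ls sn _; apply: lyn_span_brr aS; first by rewrite addn1.
move=> t lt' t1 _.
have [st|] := eqVneq s t.
  have n0 : n = 0%N by move: sn; rewrite st t1; case.
  by rewrite st n0 brxx //; exact: lyn_span0.
have nE : n.+2 = (size s + size t)%N by lia.
move=> nst; suff : lyn_span (fun=> True)
    (br n.+2 (lyn_class (size s) s) (lyn_class (size t) t)) by rewrite sn t1.
case/(lexlt_total lt_wo)/orP: nst => h.
  exact: (lyn_spanS _ (lyn_span_bracket ls lt' h nE)).
rewrite brC //; apply: lyn_spanN.
by apply: (lyn_spanS _ (lyn_span_bracket lt' ls h _)) => //; lia.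
Qed.

(** * Injectivity of the leading part, and the center *)

Section Triangular.
Variable mu : G -> unit_series X.
Hypothesis muM : forall x y, kernel w x -> kernel w y -> mu (x * y)%g = (mu x * mu y)%g.
Hypothesis mu_letter : forall x, mu (b x) = us_letter x.
Local Notation magnus := (magnus mu).

(** In [u v - v u] every word of the second product is at least [v ++ u], which is
    larger than [u ++ v] as [u ++ v < v]; so the smallest word is [u ++ v], with
    coefficient 1. *)
Lemma magnus_bracketing s g : bracketing s g ->
  magnus g s = 1 /\ forall t, size t = size s -> t <l s -> magnus g t = 0.
Proof.
elim=> [x|u v gu gv lu lv uv _ bu [gu1 gu0] bv [gv1 gv0]].
  rewrite /magnus mu_letter /=; split.
    by rewrite addsE add0r /letter_series eqxx.
  move=> [//|y [|//]] _ /=; rewrite orbC andbF /= => yx.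
  rewrite addsE add0r /letter_series eqseq_cons andbT.
  case: eqP yx => // ->; have [irr _ _ _] := lt_wo; by rewrite irr.
have [ixu ixv] := (bracketing_Gam bu, bracketing_Gam bv).
have [su sv] := (size_lyn lu, size_lyn lv).
set p := magnus gu - 1; set q := magnus gv - 1.
have pE t : (0 < size t)%N -> magnus gu t = p t.
  by move=> t0; rewrite /p subsE one_series_pos // subr0.
have qE t : (0 < size t)%N -> magnus gv t = q t.
  by move=> t0; rewrite /q subsE one_series_pos // subr0.
have op : order_ge (size u) p.
  by case: (size u) su ixu => // k _ ixu; exact: (magnus_ord muM).
have oq : order_ge (size v) q.
  by case: (size v) sv ixv => // k _ ixv; exact: (magnus_ord muM).
have E t : size t = size (u ++ v) -> magnus [~ gu, gv]%g t =
    p (take (size u) t) * q (drop (size u) t) - q (take (size v) t) * p (drop (size v) t).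
  rewrite size_cat => st.
  have -> : magnus [~ gu, gv]%g t = (p * q - q * p) t.
    move: st ixu ixv su sv; case: (size u) => // i; case: (size v) => // j st ixu ixv _ _.
    exact: (magnus_comm_lead muM ixu ixv).
  rewrite subsE -{1}[t](cat_take_drop (size u)) (conv_lead op oq); first last.
  - by rewrite size_drop st addKn.
  - by rewrite size_takel // st leq_addr.
  rewrite -{3}[t](cat_take_drop (size v)) (conv_lead oq op) //.
    by rewrite size_takel // st leq_addl.
  by rewrite size_drop st addnK.
have qp0 t : size t = size (u ++ v) -> (t = u ++ v \/ t <l u ++ v) ->
    q (take (size v) t) * p (drop (size v) t) = 0.
  rewrite size_cat => st tuv.
  have s1 : size (take (size v) t) = size v by rewrite size_takel // st leq_addl.
  have s2 : size (drop (size v) t) = size u by rewrite size_drop st addnK.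
  have uvvu : u ++ v <l v ++ u.
    apply: (lexlt_trans lt_wo (cat_ltr lt_wo lv uv lu.1)).
    by apply: lexlt_prefix => //; exact: lu.1.
  have : t <l v ++ u by case: tuv => [->//|tuv]; exact: (lexlt_trans lt_wo tuv).
  rewrite -{1}[t](cat_take_drop (size v)) lexlt_cat_size //.
  case/orP => [h|/andP[_ h]].
    by rewrite -qE ?s1 // gv0 // mul0r.
  by rewrite -[p _]pE ?s2 // gu0 // mulr0.
split.
  rewrite E // qp0 //; last by left.
  by rewrite subr0 take_size_cat // drop_size_cat // -pE // -qE // gu1 gv1.
move=> t st tuv; rewrite E // qp0 //; last by right.
rewrite size_cat in st.
have s1 : size (take (size u) t) = size u by rewrite size_takel // st leq_addr.
have s2 : size (drop (size u) t) = size v by rewrite size_drop st addKn.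
rewrite subr0; move: tuv; rewrite -{1}[t](cat_take_drop (size u)) lexlt_cat_size //.
case/orP => [h|/andP[_ h]].
  by rewrite -pE ?s1 // gu0 // mul0r.
by rewrite -[q _]qE ?s2 // gv0 // mulr0.
Qed.

(** In a combination of bracketings, the coefficient of the smallest word [s0]
    that occurs is the total coefficient of [s0], as larger words do not
    contribute; if it is zero, the terms of [s0] can be removed. *)
Lemma lead_inj n (u : gr w n.+1) :
  (forall s, size s = n.+1 -> lead mu u s = 0) -> u = 0.
Proof.
have [l [lP ->]] := lyn_span_all u.
have [k] := ubnP (size l); elim: k l lP => // k IH l lP lk lead0.
have [->|l0] := eqVneq l [::]; first by rewrite big_nil.
have [|s0 [[p0 p0l p0E] _ m0]] :=
  @lexlt_min _ lt lt_wo n.+1 (fun s => exists2 p, p \in l & p.2 = s).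
  case: l lP l0 {lk lead0} => // p l lP _; exists p.2; first by exists p; rewrite ?mem_head.
  by have [_ ->] := lP p (mem_head _ _).
have [ls0 sn0 _] : [/\ lyn s0, size s0 = n.+1 & True] by rewrite -p0E; exact: lP.
pose f (x : gr w n.+1) : int := lead mu x s0.
have fB : {morph f : x y / x - y} by move=> x y; exact: (leadB muM).
pose fm := GRing.isZmodMorphism.Build (gr w n.+1) int f fB.
pose fa : {additive gr w n.+1 -> int} := HB.pack f fm.
have f_class p : p \in l -> f (lyn_class n.+1 p.2) = (p.2 == s0)%:R.
  move=> pl; have [lp sp _] := lP p pl.
  have bp := lyndon_bracketP lp; have [m1 m2] := magnus_bracketing bp.
  rewrite /f /lyn_class (lead_cl muM) //; last by rewrite -sp; exact: lyndon_bracket_Gam.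
  have [<-//|ps] := eqVneq p.2 s0.
  apply: m2; first by rewrite sp.
  case/orP: (lexlt_total lt_wo ps) => // h.
  by have := m0 p.2 (ex_intro2 _ _ p pl (erefl _)); rewrite sp leqnn h => /(_ isT).
have c0 : \sum_(p <- l | p.2 == s0) p.1 = 0.
  have := lead0 s0 sn0; rewrite -/(f _) -[f _]/(fa _) raddf_sum => fl.
  rewrite -[RHS]fl big_mkcond /= !big_seq; apply: eq_bigr => p pl.
  have -> : f (lyn_class n.+1 p.2 *~ p.1) = f (lyn_class n.+1 p.2) *~ p.1.
    exact: (raddfMz fa).
  by rewrite f_class //; case: eqP => _; rewrite ?mul0rz // intz.
have lE : \sum_(p <- l) lyn_class n.+1 p.2 *~ p.1 =
    \sum_(p <- [seq p <- l | p.2 != s0]) lyn_class n.+1 p.2 *~ p.1.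
  rewrite (bigID (fun p => p.2 == s0)) /= big_filter.
  rewrite (eq_bigr (fun p => lyn_class n.+1 s0 *~ p.1)); last by move=> p /eqP->.
  by rewrite -mulrz_sumr c0 mulr0z add0r.
rewrite lE; apply: IH; last by move=> s sn; rewrite -lE; exact: lead0.
  by move=> p; rewrite mem_filter => /andP[_]; exact: lP.
apply: (@leq_trans (size l)); last by rewrite -ltnS.
rewrite size_filter -(count_predC (fun p => p.2 == s0) l).
rewrite -[X in (X < _)%N]add0n ltn_add2r -has_count; apply/hasP; exists p0 => //.
exact/eqP.
Qed.

End Triangular.
End LyndonBasis.

Section Center.
Local Open Scope ring_scope.
Variables (X : eqType) (G F : groupType) (w : {ghom G -> F}) (b : X -> G).
Hypothesis fA : free_subgroup (kernel w) b.

Lemma gr_center n (u : gr w n.+1) (x1 x2 : X) : x1 != x2 ->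
  (forall a : gr w 1, br n.+2 u a = 0) -> u = 0.
Proof.
move=> x12 uc; have [lt lt_wo] := strict_well_order_ex X.
have [_ bA bgen /(_ _ (@us_letter X))[mu [muM mu_letter]]] := fA.
apply: (lead_inj lt_wo bA bgen muM mu_letter).
by apply: (lead_central muM mu_letter bA x12).
Qed.

End Center.

(** * Extending maps of degree 1 to derivations *)

Section ExtendDerivation.
Local Open Scope ring_scope.
Variables (X : Type) (G F : groupType) (w : {ghom G -> F}) (b : X -> G).
Hypothesis fA : free_subgroup (kernel w) b.
Local Notation Gam := (lcs (kernel w)).
Local Notation A := (kernel w).

(** The group-theoretic Leibniz rule.  Positivity of [m] makes the cross term
    [[~ c, e]] negligible. *)
Lemma comm_shift i j m x y c e : (0 < m)%N -> Gam i x -> Gam j y ->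
  Gam (i + m) c -> Gam (j + m) e ->
  let z := ([~ c * x, e * y] * [~ x, y]^-1)%g in
  Gam (i + j + m) z /\
  cl w (i + j + m) z = br (i + j + m) (cl w (i + m) c) (cl w j y) +
                       br (i + j + m) (cl w i x) (cl w (j + m) e).
Proof.
move=> m0 ix jy ic je z.
have [xA yA] := (Gam_ker ix, Gam_ker jy).
have ey : Gam j (e * y)%g by apply: (subgroupM (Gam_subgroup _ _)) => //; exact: GamW je.
have kA : A (y * [~ x, y]^-1)%g.
  apply: (subgroupM (kernel_subgroup w)) => //; apply: (subgroupV (kernel_subgroup w)).
  exact: (Gam_ker (Gam_comm (erefl _) ix jy)).
have zE : z = ([~ c, e * y] ^ x * [~ x, e] ^ (y * [~ x, y]^-1))%g.
  have conjE (p q r : G) : (p * (q * r) * q^-1 = p * r ^ q^-1)%g.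
    by rewrite conjgE invgK !mulgA.
  by rewrite /z commgMl (commgMr x e y) conjE conjgM.
have n1 : (i + j + m)%N = (i + m + j)%N by lia.
have n2 : (i + j + m)%N = (i + (j + m))%N by lia.
have g1 := Gam_comm n1 ic ey; have g2 := Gam_comm n2 ix je.
have g1' := Gam_normal x g1; have g2' := Gam_normal (y * [~ x, y]^-1)%g g2.
rewrite zE; split; first exact: (subgroupM (Gam_subgroup _ _)).
rewrite clM // !clJ // -(br_clE n1 ic ey) -(br_clE n2 ix je); congr (br _ _ _ + _).
rewrite clM ?(@clS _ _ w j e) ?add0r //; last exact: GamW je.
by case: m m0 je {ic z zE n1 n2 g1 g2 g1' g2'} => // m _; rewrite -addSnnS; exact: GamW.
Qed.

Variables (m : nat) (delta : gr w 1 -> gr w (1 + m)).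
Hypothesis m0 : (0 < m)%N.
Hypothesis deltaD : forall u v, delta (u + v) = delta u + delta v.

Lemma deltaB u v : delta (u - v) = delta u - delta v.
Proof. by apply/eqP; rewrite eq_sym subr_eq -deltaD subrK. Qed.

(** With [psi] the endomorphism of [A] multiplying each letter by a representative
    of its image under [delta], [D x := psi x * x^-1] maps [Gam i] to
    [Gam (i + m)]: by induction on [i], using [comm_shift] on commutators.  The
    maps it induces on the quotients are a derivation, again by [comm_shift]. *)
Lemma extend_derivation : exists d : forall i, gr w i -> gr w (i + m),
  [/\ forall i (u v : gr w i), d i (u + v) = d i u + d i v,
      forall i j (u : gr w i) (v : gr w j), d (i + j)%N (br (i + j) u v) =
          br (i + j + m) (d i u) v + br (i + j + m) u (d j v)
    & d 1%N = delta].
Proof.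
have [sA bA bgen ext] := fA.
have [psi [psiM psib]] := ext G (fun x => rep (delta (cl w 1 (b x))) * b x)%g.
pose D x := (psi x * x^-1)%g.
have DM x y : A x -> A y -> D (x * y)%g = (D x * D y ^ x^-1)%g.
  by move=> Ax Ay; rewrite /D psiM // invgM conjgE invgK !mulgA mulgVK.
have psi1 : psi 1%g = 1%g.
  by apply: (mulgI (psi 1%g)); rewrite mulg1 -psiM ?mulg1 //; exact: sA.1.
have psiV x : A x -> psi x^-1%g = (psi x)^-1%g.
  move=> Ax; apply: (mulgI (psi x)); rewrite mulgV -psiM ?mulgV //.
  exact: (subgroupV sA).
have DV x : A x -> D x^-1%g = ((D x)^-1 ^ x)%g.
  by move=> Ax; rewrite /D psiV // invgK conjgE invgM invgK -!mulgA mulKg.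
have psiE x : psi x = (D x * x)%g by rewrite mulgVK.
have Dsub i k : subgroup [set x | Gam i x /\ Gam k (D x)]%classic.
  split.
    split; first exact: (Gam_subgroup w i).1.
    by rewrite /D psi1 mulgV; exact: (Gam_subgroup w k).1.
  move=> x y [ix kx] [iy ky]; split; first exact: (Gam_subgroup w i).2.
  have [Ax Ay] := (Gam_ker ix, Gam_ker iy).
  rewrite DM // ?DV //; last exact: (subgroupV sA).
  apply: (subgroupM (Gam_subgroup w k)) => //; do 2!apply: Gam_normal.
  exact: (subgroupV (Gam_subgroup w k)).
have Db x : D (b x) = rep (delta (cl w 1 (b x))) by rewrite /D psib mulgK.
have D1 x : A x -> Gam (1 + m) (D x).
  move=> Ax; suff : [set x | Gam 1 x /\ Gam (1 + m) (D x)]%classic x by case.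
  apply: gen_sub (bgen x Ax); first exact: Dsub.
  move=> _ [y _ <-]; split; first exact: bA.
  by rewrite Db; exact: repP.
have Dcomm x y : A x -> A y -> D [~ x, y]%g = ([~ D x * x, D y * y] * [~ x, y]^-1)%g.
  move=> Ax Ay; rewrite /D -!psiE; congr (_ * _)%g.
  have [Vx Vy] := (subgroupV sA Ax, subgroupV sA Ay).
  have Axy := subgroupM sA Ax Ay; have Ayxy := subgroupM sA Vy Axy.
  by rewrite !commgEl !conjgE (psiM x^-1)%g // (psiM y^-1)%g // psiM // !psiV.
have DG i x : Gam i x -> Gam (i + m) (D x).
  elim: i x => [|n IH] x ix; first exact: Gam_decr (D1 x ix).
  case: n IH ix => [|n] IH ix; first exact: D1.
  suff : [set x | Gam n.+2 x /\ Gam (n.+2 + m) (D x)]%classic x by case.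
  move: ix; rewrite {1}lcsSS; apply: gen_sub; first exact: Dsub.
  move=> _ [y [z [iy Az ->]]].
  have Ay := Gam_ker iy; have iz : Gam 1 z by [].
  split; first by apply: (@Gam_comm _ _ w n.+1 1); rewrite ?addn1.
  rewrite Dcomm //; have := (comm_shift m0 iy iz (IH _ iy) (D1 _ Az)).1.
  by rewrite addn1.
pose d i (u : gr w i) : gr w (i + m) := cl w (i + m) (D (rep u)).
have d_cl i x : Gam i x -> d i (cl w i x) = cl w (i + m) (D x).
  move=> ix; rewrite /d; have ci := rep_cl ix.
  set c := (_ * _)%g in ci; have -> : rep (cl w i x) = (c * x)%g by rewrite mulgVK.
  have ci' := Gam_decr ci; have Ac := Gam_ker ci'; have Ax := Gam_ker ix.
  rewrite DM // clM; try exact: DG; last by apply: Gam_normal; exact: DG.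
  rewrite clJ //; [|exact: DG|exact: (subgroupV sA)].
  by rewrite [X in X + _]clS ?add0r //; exact: (DG i.+1).
have dD i (u v : gr w i) : d i (u + v) = d i u + d i v.
  elim/gr_elim: u => x ix; elim/gr_elim: v => y iy.
  have [Ax Ay] := (Gam_ker ix, Gam_ker iy).
  have ixy := subgroupM (Gam_subgroup w i) ix iy.
  rewrite -clM // !d_cl // DM // clM ?clJ //; try exact: DG.
    exact: (subgroupV sA).
  by apply: Gam_normal; exact: DG.
exists d; split=> //.
- move=> i j u v; elim/gr_elim: u => x ix; elim/gr_elim: v => y iy.
  have [Ax Ay] := (Gam_ker ix, Gam_ker iy).
  rewrite br_cl // !d_cl //; last exact: Gam_comm ix iy.
  by rewrite Dcomm // (comm_shift m0 ix iy (DG _ _ ix) (DG _ _ iy)).2.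
apply/funext; elim/gr_elim => x /bgen.
pose P (u : gr w 1) := d 1%N u = delta u.
have sub1 : subzmod P.
  split=> [|u v du dv]; rewrite /P.
    have -> : d 1%N 0 = 0 by apply: (addrI (d 1%N 0)); rewrite -dD !addr0.
    by rewrite -(subrr 0) deltaB subrr.
  rewrite deltaB -du -dv.
  by apply/eqP; rewrite eq_sym subr_eq -dD subrK.
apply: (cl_gen sub1).
  by apply: gen_sub; [exact: Gam_subgroup|move=> _ [y _ <-]; exact: bA].
move=> _ [y _ <-]; rewrite /P d_cl; last exact: bA.
by rewrite Db; exact: repK.
Qed.

End ExtendDerivation.

(** * Derivations and quasi-equivariant maps *)

Lemma dsumD (T : nat -> zmodType) (x y : dsum T) n : (x + y)%R n = (x n + y n)%R.
Proof. exact: (congr1 (fun h : dprod T => h n) (raddfD (val : dsum T -> _) x y)). Qed.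

Section DegreeOnePart.
Local Open Scope ring_scope.
Variables (G F : groupType) (w : {ghom G -> F}).

Lemma gr0_eq (u v : gr w 0) : u = v.
Proof. by rewrite [u]gr0_eq0 [v]gr0_eq0. Qed.

Lemma brp_of_deg1 (v : Aplus w) (a : gr w 1) n :
  brp v (of_deg1 a) n.+1 = br n.+1 (v n : gr w n) a.
Proof.
have brE j m (u : gr w j) i : i = 1%N ->
    br m u (of_deg1 a i : gr w i) = br m u a by move=> ->.
rewrite -[LHS]/(\sum_(i < n.+2) _) (bigD1 (inord n)) //= inordK //.
rewrite brE ?subSnn // big1 ?addr0 // => i ne.
have i1 : (n.+1 - i)%N <> 1%N.
  move=> E; case/eqP: ne; apply: val_inj; rewrite /= inordK //.
  by have := ltn_ord i; lia.
case: (n.+1 - i)%N i1 (subnKC (ltn_ord i : (i <= n.+1)%N)) => [|[|k]] // _ E;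
  by rewrite br0r // -E.
Qed.

Hypothesis surj : forall f, exists x, w x = f.
Hypothesis center : forall n (u : gr w n.+1),
  (forall a : gr w 1, br n.+2 u a = 0) -> u = 0.

Lemma derivation0 m (d : prederivation w m) i : is_derivation d -> d.2 i 0 = 0.
Proof.
by case=> _ dD _ _; apply: (addrI (d.2 i 0)); rewrite -dD !addr0.
Qed.

Lemma derivationB m (d : prederivation w m) i u u' : is_derivation d ->
  d.2 i (u - u') = d.2 i u - d.2 i u'.
Proof.
by case=> _ dD _ _; apply/eqP; rewrite eq_sym subr_eq -dD subrK.
Qed.

Lemma derivation_br m (d : prederivation w m) i j n (u : gr w i) (v : gr w j) :
  is_derivation d -> n = (i + j)%N ->
  d.2 n (br n u v) = br (n + m) (d.2 i u) v + br (n + m) u (d.2 j v).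
Proof. by case=> _ _ dbr _ ->; exact: dbr. Qed.

Lemma derivation_eq0 k (d : prederivation w k.+1) : is_derivation d ->
  (forall u, d.2 1%N u = 0) -> d = 0.
Proof.
move=> dd d10; have [_ _ _ dact] := dd.
have d_0 i u : d.2 i u = 0.
  case: i u => [|i] u; first by rewrite [u]gr0_eq0 derivation0.
  move: i u; apply: gr_ind1 => [n|u|n u a IH]; last 1 first.
  - rewrite (derivation_br _ _ dd) ?addn1 // IH d10 br0l ?br0r ?addr0 //; lia.
  - split=> [|x y hx hy]; first exact: derivation0.
    by rewrite derivationB // hx hy subr0.
  - exact: d10.
have d0_0 f : d.1 f = 0.
  apply: center => a; have := dact 1%N f (act f^-1%g a).
  by rewrite !d_0 act0 add0r actK.
rewrite [d]surjective_pairing; congr pair; first by apply/funext => f; exact: d0_0.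
by apply: functional_extensionality_dep => i; apply/funext => u; exact: d_0.
Qed.

Variable z : gr w 1.

Lemma der_zetaP k (d : der_zeta z k) : is_derivation (der_val d) /\ (der_val d).2 1%N z = 0.
Proof. exact/asboolP/(der_valP d). Qed.

Lemma deg1_partB (d e : Der_plus_zeta z) :
  deg1_part (d - e) = deg1_part d - deg1_part e.
Proof.
apply/funext => a; apply: dsumP => -[|[|k]]; first exact: gr0_eq.
  by rewrite [RHS]dsumB subrr.
by rewrite [RHS]dsumB /=.
Qed.

(** The axiom on [d_1 (f b)] at [b := f^-1 a] reads [f d_1 - d_1 = [- d_0 f, -]]. *)
Lemma deg1_part_D1 (d : Der_plus_zeta z) : deg1_part d \in D1_pred z.
Proof.
apply/asboolP; split.
- move=> a b; apply: (addIr (- deg1_part d b)); rewrite addrK.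
  apply: dsumP => -[|[|k]]; rewrite dsumB /= ?subrr //.
  by have [[_ -> _ _] _] := der_zetaP (d k); rewrite addrK.
- move=> f.
  have fin : exists N, forall n, (N <= n)%N ->
      match n return gr w n with k.+1 => - (der_val (d k)).1 f | 0 => 0 end = 0.
    have [N dN] := dsum_finite d; exists N.+1 => -[//|n] Nn.
    by rewrite dN // oppr0.
  exists (@mk_dsum (gr_family w) _ fin) => a; apply: dsumP => -[|[|k]].
  + exact: gr0_eq.
  + by rewrite brp_of_deg1 dsumB subr0 br0l //= act0.
  rewrite brp_of_deg1 dsumB /=.
  have [dd _] := der_zetaP (d k); have [_ _ _ dact] := dd.
  have := dact 1%N f (act f^-1%g a); rewrite actK // => ->.
  by rewrite opprD addrA subrr add0r brNl ?addn1.
- by move=> a [|[|n]] // _; exact: gr0_eq0.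
apply: dsumP => -[|[|k]] //=; exact: (der_zetaP (d k)).2.
Qed.

Lemma deg1_part_inj : injective (@deg1_part _ _ _ z).
Proof.
move=> d e de; apply: dsumP => k; apply: val_inj => /=.
have [dd _] := der_zetaP (d k - e k : der_zeta z k.+1).
have dB : der_val (d k - e k : der_zeta z k.+1) = der_val (d k) - der_val (e k) by [].
apply/eqP; rewrite -subr_eq0 -dB; apply/eqP; apply: derivation_eq0 => // u.
have /(congr1 (fun h : gr w 1 -> Aplus w => h u k.+2)) /= := de.
by move=> E; rewrite -[LHS]/((der_val (d k)).2 1%N u - (der_val (e k)).2 1%N u) E subrr.
Qed.

Variables (gF : seq F) (gA : seq (gr w 1)).
Hypothesis gF_gen : forall K : set F, subgroup K ->
  (forall f, f \in gF -> K f) -> forall f, K f.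
Hypothesis gA_gen : forall P : gr w 1 -> Prop, subzmod P ->
  (forall f a, a \in gA -> P (act f a)) -> forall a, P a.
Hypothesis extend : forall m (delta : gr w 1 -> gr w (1 + m)), (0 < m)%N ->
  (forall u v, delta (u + v) = delta u + delta v) ->
  exists d : forall i, gr w i -> gr w (i + m),
  [/\ forall i (u v : gr w i), d i (u + v) = d i u + d i v,
      forall i j (u : gr w i) (v : gr w j), d (i + j)%N (br (i + j) u v) =
          br (i + j + m) (d i u) v + br (i + j + m) u (d j v)
    & d 1%N = delta].

(** The identity [d_i (f u) = f d_i u + [d_0 f, f u]] passes from [u] and [a] to
    their bracket because [ad (d_0 f)] is a derivation.  It also computes
    [[d_0 f, f a]] in terms of [d_1], and comparing the results for [x * y], [x] and
    [y] gives the cocycle identity up to a central element. *)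
Lemma extend_quasi_equivariant m (delta : gr w 1 -> gr w m.+2) (v : F -> gr w m.+1) :
  (forall a a', delta (a + a') = delta a + delta a') ->
  (forall f a, act f (delta (act f^-1%g a)) - delta a = br m.+2 (v f) a) ->
  exists d : prederivation w m.+1,
    [/\ is_derivation d, d.2 1%N = delta & forall f, d.1 f = - v f].
Proof.
move=> deltaD qe; have [d [dD dbr d1]] := extend (m := m.+1) (isT : 0 < m.+1)%N deltaD.
have dB i (x y : gr w i) : d i (x - y) = d i x - d i y.
  by apply/eqP; rewrite eq_sym subr_eq -dD subrK.
have d_0 i : d i 0 = 0 by rewrite -(subrr 0) dB subrr.
have dbrE n i j (x : gr w i) (y : gr w j) : n = (i + j)%N ->
    d n (br n x y) = br (n + m.+1) (d i x) y + br (n + m.+1) x (d j y).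
  by move=> ->; exact: dbr.
have actVK n f (x : gr w n) : act f^-1%g (act f x) = x.
  by have := actK x (surj f^-1%g); rewrite invgK.
have act1E f a : d 1%N (act f a) = act f (d 1%N a) + br (1 + m.+1) (- v f) (act f a).
  have := qe f (act f a); rewrite actVK d1 => /(congr1 (fun x => act f (delta a) - x)).
  by rewrite opprB addrC subrK brNl ?addn1.
have actE i f (u : gr w i) : d i (act f u) = act f (d i u) + br (i + m.+1) (- v f) (act f u).
  case: i u => [|i] u; first by rewrite [u]gr0_eq0 act0 d_0 act0 br0r ?addr0 // addnC.
  move: i u f; apply: (@gr_ind1 _ _ w (fun i u => forall f, d i.+1 (act f u) =
    act f (d i.+1 u) + br (i.+1 + m.+1) (- v f) (act f u))) => [n|u f|n u a IH f].
  - split=> [f|x y hx hy f]; first by rewrite act0 d_0 act0 br0r ?addr0 // addnC.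
    by rewrite actB !dB actB hx hy brBr ?[(n.+1 + _)%N]addnC // opprD addrACA.
  - exact: act1E.
  have nE : n.+2 = (n.+1 + 1)%N by rewrite addn1.
  have E1 : (n.+2 + m.+1 = n.+1 + m.+1 + 1)%N by lia.
  have E2 : (n.+2 + m.+1 = n.+1 + (1 + m.+1))%N by lia.
  have E3 : (n.+2 + m.+1 = m.+1 + n.+1 + 1)%N by lia.
  rewrite (act_br u a nE (surj f)) !(dbrE _ _ _ _ _ nE) actD IH act1E.
  rewrite (act_br (d n.+1 u) a E1 (surj f)) (act_br u (d 1%N a) E2 (surj f)).
  rewrite brDl // brDr // addrACA; congr (_ + _).
  by apply: br_leibniz; lia.
exists ((fun f => - v f), d); split=> //; split=> //= x y.
apply/eqP; rewrite -subr_eq0; apply/eqP; apply: center => c.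
have xy : exists g, w g = (x * y)%g := surj _.
rewrite -[c](actK _ xy); set e := act _ c.
have nE : m.+2 = (m.+1 + 1)%N by rewrite addn1.
have brE f a : br m.+2 (- v f) (act f a) = d 1%N (act f a) - act f (d 1%N a).
  by rewrite act1E addrC addKr.
rewrite brBl // brDl // brE (actM _ (surj x) (surj y)) brE -(act_br _ _ nE (surj x)) brE.
by rewrite actB (actM (d 1%N e) (surj x) (surj y)) addrA subrK subrr.
Qed.

Lemma derivation_gen_eq0 m (d : prederivation w m.+1) : is_derivation d ->
  (forall f, f \in gF -> d.1 f = 0) -> (forall a, a \in gA -> d.2 1%N a = 0) -> d = 0.
Proof.
move=> dd df da; have [d0M dD dbr dact] := dd.
have d10 : d.1 1%g = 0.
  by apply: (addrI (d.1 1%g)); rewrite addr0 -[in RHS](mulg1 1%g) d0M act1.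
have d0 f : d.1 f = 0.
  apply: (gF_gen (K := [set f | d.1 f = 0]%classic)) => //; split=> // x y /= dx dy.
  rewrite d0M dx add0r; have : d.1 (y^-1 * y)%g = 0 by rewrite mulVg.
  by rewrite d0M dy act0 addr0 => ->; rewrite act0.
apply: derivation_eq0 => //; apply: gA_gen.
  split=> [|x y hx hy]; first exact: derivation0.
  by rewrite derivationB // hx hy subr0.
by move=> f a ga; rewrite dact da // act0 d0 br0l ?addr0 // addnC.
Qed.

(** The values [delta a] and the [v f] are finite sums, but the number of their
    terms depends on [a] and [f]; a common bound for the generators bounds the
    degrees of the nonzero derivations. *)
Lemma deg1_part_surj (e : D1_plus z) : exists d : Der_plus_zeta z, deg1_part d = D1_val e.
Proof.
have /asboolP[eD eqe e2 ez] := D1_valP e; set delta := D1_val e in eD eqe e2 ez *.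
have [v vE] := choice eqe.
have ex k : exists d : der_zeta z k.+1, (der_val d).2 1%N = (fun a => delta a k.+2) /\
    forall f, (der_val d).1 f = - (v f k.+1 : gr w k.+1).
  have [|f a|d [dd d1 d0]] := @extend_quasi_equivariant k
      (fun a => delta a k.+2 : gr w k.+2) (fun f => v f k.+1 : gr w k.+1).
  - by move=> a a'; rewrite eD dsumD.
  - by have /(congr1 (fun h : Aplus w => h k.+2)) := vE f a; rewrite dsumB brp_of_deg1.
  have dP : d \in der_zeta_pred z (m := k.+1).
    by apply/asboolP; split=> //; rewrite d1 ez dsum0.
  by exists (DerZeta dP).
pose D k : der_zeta z k.+1 := projT1 (cid (ex k)).
have DE k := projT2 (cid (ex k)).
have finF f : exists N, forall n, (N <= n)%N -> (v f n : gr w n) = 0 :=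
  dsum_finite (v f).
have finA a : exists N, forall n, (N <= n)%N -> (delta a n : gr w n) = 0 :=
  dsum_finite (delta a).
have [NF NFE] := choice finF; have [NA NAE] := choice finA.
pose N := maxn (\max_(f <- gF) NF f) (\max_(a <- gA) NA a).
have fin : exists N, forall n, (N <= n)%N -> (D n : der_family z n) = 0.
  exists N => n Nn; apply: val_inj; have [dd _] := der_zetaP (D n); have [D1 D0] := DE n.
  apply: derivation_gen_eq0 => // [f fF|a aA].
    rewrite D0 NFE ?oppr0 //; apply: leqW; apply: leq_trans Nn.
    by rewrite leq_max (leq_bigmax_seq _ fF).
  rewrite D1 NAE //; do 2!apply: leqW; apply: leq_trans Nn.
  by rewrite leq_max (leq_bigmax_seq _ aA) ?orbT.
exists (@mk_dsum (der_family z) _ fin); apply/funext => a; apply: dsumP => -[|[|k]] /=.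
- by rewrite e2.
- by rewrite e2.
by have [-> _] := DE k.
Qed.

Definition to_D1 (d : Der_plus_zeta z) : D1_plus z := D1Plus (deg1_part_D1 d).

Lemma to_D1B : {morph to_D1 : d e / d - e}.
Proof. by move=> d e; apply: val_inj; exact: deg1_partB. Qed.
HB.instance Definition _ := GRing.isZmodMorphism.Build _ _ to_D1 to_D1B.

Lemma deg1_part_iso : exists Phi : {additive Der_plus_zeta z -> D1_plus z},
  bijective Phi /\ forall d, D1_val (Phi d) = deg1_part d.
Proof.
exists to_D1; split=> //.
have surjD e : exists d, to_D1 d = e.
  by have [d dE] := deg1_part_surj e; exists d; apply: val_inj.
have [g gE] := choice surjD; exists g => // d; apply: deg1_part_inj.
by have /(congr1 (@D1_val _ _ _ _)) := gE (to_D1 d).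
Qed.

End DegreeOnePart.

Theorem proposition8p4 (g : nat) (G F : groupType) (w : {ghom G -> F})
    (zeta : G) :
  (0 < g)%N -> handlebody_groups g w zeta ->
  exists Phi : {additive Der_plus_zeta (cl w 1 zeta) -> D1_plus (cl w 1 zeta)},
    bijective Phi /\
    (forall d : Der_plus_zeta (cl w 1 zeta), D1_val (Phi d) = deg1_part d).
Proof.
case: g => // g _ [alpha [beta [fG fF wa _]]].
have [s [_ ws]] := ghom_section fF.
have [b [fA bE]] := free_kernel fG fF wa.
have [sA bA bgen _] := fA.
(* The kernel has at least two letters, since [F] is not trivial: map it to the
   units of the power series in one letter. *)
have wb : w (beta ord0) <> 1%g.
  have [h hE] := (fF (unit_series unit) (fun=> us_letter tt)).1.
  move=> w1; have := hE ord0; rewrite w1 gmulf1.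
  by move=> /(congr1 (fun p => us_val p [:: tt])).
apply: (@deg1_part_iso _ _ w _ _ _ [seq w (beta j) | j : 'I_g.+1]
  [seq cl w 1 (alpha i) | i : 'I_g.+1]).
- by move=> f; exists (s f).
- move=> n u uc; apply: (@gr_center _ _ _ w b fA n u (1%g, ord0) (w (beta ord0), ord0)) => //.
  by apply/eqP => -[/esym].
- move=> K sK KF; apply: (free_basis_ind sK fF) => j.
  by apply: KF; apply: (map_f (fun j => w (beta j))); rewrite mem_enum.
- move=> P sP PA; elim/gr_elim => x /bgen; apply: (cl_gen sP).
    by apply: gen_sub; [exact: Gam_subgroup|move=> _ [y _ <-]; exact: bA].
  move=> _ [[f i] _ <-]; have [y <- ->] := bE f i.
  rewrite -act_cl; last exact: wa.
  by apply: PA; apply: (map_f (fun i => cl w 1 (alpha i))); rewrite mem_enum.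
by move=> m delta m0 dD; exact: (extend_derivation fA).
Qed.
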